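(* Let $\mathcal{T}$ be a tree chosen uniformly at random from the labelled trees on the vertex set $[n]$, and let $c(n)$ be the number of sub-trees of $\mathcal{T}$. Then asymptotically almost surely $c(n)\ge 1.41805^n$.
   Context: A sub-tree is a non-empty vertex subset inducing a connected subgraph. An event holds asymptotically almost surely if its probability tends to $1$ as $n\to\infty$. *)

(* Defs.v *)
From HB Require Import structures.
From mathcomp Require Import all_boot all_order all_algebra.
From mathcomp Require Import all_classical all_reals all_analysis.

Set Implicit Arguments.
Unset Strict Implicit.
Unset Printing Implicit Defensive.

Import Order.TTheory GRing.Theory Num.Theory.
Import numFieldNormedType.Exports.

Local Open Scope ring_scope.

(* A graph on the vertex set V is given by its set of edges, an edge being a
   two-element subset of V. *)
Definition simple_graph (V : finType) (E : {set {set V}}) : bool :=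
  [forall e in E, #|e| == 2%N].

(* Irreflexive when E is a simple graph, since [set x; x] has cardinal 1. *)
Definition adj (V : finType) (E : {set {set V}}) : rel V :=
  [rel x y | [set x; y]%SET \in E].

Definition induced_adj (V : finType) (E : {set {set V}}) (S : {set V}) :
    rel V :=
  [rel x y | [&& x \in S, y \in S & adj E x y]].

Definition induces_connected (V : finType) (E : {set {set V}}) (S : {set V}) :
    bool :=
  (S != finset.set0)
  && [forall x in S, forall y in S, connect (induced_adj E S) x y].

(* Closed walks of length at most 2 along distinct vertices are not cycles of
   a simple graph: ucycle accepts [:: x; y] as soon as x and y are adjacent. *)
Definition acyclic (V : finType) (E : {set {set V}}) : Prop :=
  forall c : seq V, (2 < size c)%N -> ~ ucycle (adj E) c.

Definition is_tree (V : finType) (E : {set {set V}}) : Prop :=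
  [/\ simple_graph E, induces_connected E (finset.setT : {set V}) & acyclic E].

Definition labelled_trees (n : nat) : {set {set {set 'I_n}}} :=
  [set E : {set {set 'I_n}} | `[< is_tree E >]]%SET.

Definition subtrees (V : finType) (E : {set {set V}}) : {set {set V}} :=
  [set S : {set V} | induces_connected E S]%SET.

Definition uniform_tree_prob (R : realType) (n : nat)
    (A : pred {set {set 'I_n}}) : R :=
  #|[set E in labelled_trees n | A E]%SET|%:R / #|labelled_trees n|%:R.

Definition aas (R : realType) (A : forall n : nat, pred {set {set 'I_n}}) :
    Prop :=
  ((fun n : nat => uniform_tree_prob R (A n)) @ \oo --> (1 : R))%classic.

(* Main.v *)
(* Root the tree at a vertex.  Writing f(v) for the number of sub-trees of the
   fringe tree at v that contain v, one has f(v) = prod (1 + f(c)) over the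
   children c of v, hence ln f(root) is the sum over the other vertices v of
   ln (1 + 1/f(v)).

   Exponential moment.  For small s > 0 the sum of f(root)^(-s) over all rooted
   labelled trees is bounded by weighting every fringe tree with f <= C by
   (1 + 1/f)^(-s).  The exponential generating function Y of these weights
   satisfies Y = x exp Y - P(x) with a polynomial P, and since
   min_y (x exp y - y) = 1 + ln x it converges at x = exp (-1 + d) for
   d = s mu (1 - O(s)), where mu is the mean of ln (1 + 1/f), restricted to
   f <= C, for the Galton-Watson tree with Poisson(1) offspring.  As there are
   at least n^(n-2) labelled trees, the proportion with f(root) < a^n decays
   exponentially as soon as mu > ln a.

   The constant.  The law p of f under the Galton-Watson measure satisfies
   sum p(f) f^(-z) = e^(-1) exp (sum p(f) (1 + f)^(-z)); applying the derivation
   induced by a prime valuation v gives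
   v(f) p(f) = sum_(d | f) v(d) p(d - 1) p(f / d), from which a fixed-point
   computation yields mu > 0.349283 > ln 1.41805 for C = 4000. *)
Require Import Defs.
From Stdlib Require Import NArith FMapPositive.
From HB Require Import structures.
From mathcomp Require Import all_boot all_order all_algebra.
From mathcomp Require Import all_classical all_reals all_analysis.
From mathcomp Require Import zify ring lra.

Set Implicit Arguments.
Unset Strict Implicit.
Unset Printing Implicit Defensive.

Import Order.TTheory GRing.Theory Num.Theory.
Import numFieldNormedType.Exports.

Local Open Scope ring_scope.
Import mathcomp.boot.fintype mathcomp.boot.finset.

(** * Lower bound for the number of labelled trees *)

Section Pruefer.
Variable V : finType.
Implicit Types (S : {set V}) (E : {set {set V}}) (c : seq V).

Lemma adj_sym E : symmetric (adj E).
Proof. by move=> x y; rewrite /adj /= finset.setUC. Qed.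

Lemma adj_mono E E' : E \subset E' -> subrel (adj E) (adj E').
Proof. by move=> /subsetP sE x y; apply: sE. Qed.

Lemma connect_adj_sym E : connect_sym (adj E).
Proof. by apply: sym_connect_sym; apply: adj_sym. Qed.

Lemma connect_mono (e e' : rel V) : subrel e e' ->
  subrel (connect e) (connect e').
Proof. by move=> h; apply: connect_sub => x y /h /connect1. Qed.

(** Any choice of leaf that depends only on the set of admissible vertices gives a Pruefer code, so
    [pick] replaces the smallest label. The last two vertices form the final edge; [set0] is a
    default that valid codes never reach. *)
Fixpoint pruefer_decode c S : {set {set V}} :=
  if c is a :: c' then
    if [pick l in S :\: [set x in c]] is Some l then
      [set l; a]%SET |: pruefer_decode c' (S :\ l)
    else set0
  else [set S]%SET.

Definition pruefer_code c S := {subset c <= S} /\ #|S| = (size c).+2.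

Lemma pruefer_code_cons a c S : pruefer_code (a :: c) S ->
  exists l, [/\ [pick l in S :\: [set x in a :: c]] = Some l,
    l \in S, l != a, l \notin c & pruefer_code c (S :\ l)].
Proof.
case=> sub card; case: pickP => [l|none]; last first.
  have : (#|S| <= #|[set x in a :: c]|)%N.
    apply: subset_leq_card; apply/subsetP => x xS.
    by have := none x; rewrite !inE xS andbT => /negbFE.
  rewrite card cardsE => /leq_trans/(_ (card_size _)) /=.
  by rewrite ltnNge leqnSn.
rewrite !inE negb_or -andbA => /and3P[la lc lS]; exists l; split=> //.
split; last by apply/eqP; rewrite -eqSS -card (cardsD1 l S) lS.
move=> x xc; rewrite !inE sub ?inE ?xc ?orbT // andbT.
by apply: contraNneq lc => <-.
Qed.

Lemma pruefer_decode_sub c S e : pruefer_code c S ->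
  e \in pruefer_decode c S -> e \subset S /\ #|e| = 2%N.
Proof.
elim: c S => [|a c IH] S cS /=; first by rewrite inE => /eqP->; case: cS.
have [l [-> lS la lc cS']] := pruefer_code_cons cS.
rewrite !inE => /orP[/eqP->|/(IH _ cS')[sub ->]].
  rewrite cards2 la; split=> //.
  by rewrite subUset !sub1set lS; case: cS => -> //; rewrite mem_head.
by split=> //; apply: subset_trans sub (subsetDl _ _).
Qed.

Definition edges_at E v := [set e in E | v \in e].

Lemma edges_at_leaf c S l a : pruefer_code c (S :\ l) ->
  edges_at ([set l; a]%SET |: pruefer_decode c (S :\ l)) l = [set [set l; a]]%SET.
Proof.
move=> cS; apply/setP => e; rewrite !inE.
have [->|ne] /= := eqVneq e [set l; a]%SET; first by rewrite !inE eqxx.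
apply/negP => /andP[/(pruefer_decode_sub cS)[/subsetP sub _] /sub].
by rewrite !inE eqxx.
Qed.

(** Each occurrence of [v] as a letter is the removal of a leaf next to it; one more edge comes from
    the removal of [v] itself or from the last pair. *)
Lemma pruefer_degree c S v : pruefer_code c S -> v \in S ->
  #|edges_at (pruefer_decode c S) v| = (count_mem v c).+1.
Proof.
elim: c S => [|a c IH] S cS vS /=.
  rewrite (_ : edges_at _ _ = [set S]%SET) ?cards1 //.
  by apply/setP => e; rewrite !inE; have [->|] := eqVneq e S.
have [l [-> lS la lc cS']] := pruefer_code_cons cS.
have [->|vl] := eqVneq v l.
  rewrite edges_at_leaf // cards1 eq_sym (negbTE la) (count_memPn _) //.
have vS' : v \in S :\ l by rewrite !inE vl.
have lE : [set l; a]%SET \notin pruefer_decode c (S :\ l).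
  apply/negP => /(pruefer_decode_sub cS')[/subsetP /(_ l)].
  by rewrite !inE !eqxx => /(_ isT).
have [av|av] := eqVneq a v.
  rewrite add1n -(IH _ cS' vS') (_ : edges_at _ v =
    [set l; a]%SET |: edges_at (pruefer_decode c (S :\ l)) v).
    by rewrite cardsU1 !inE (negbTE lE).
  apply/setP => e; rewrite !inE.
  have [->|] //= := eqVneq e [set l; a]%SET.
  by rewrite !inE av eqxx orbT.
rewrite add0n -(IH _ cS' vS'); congr (#|pred_of_set _|).
apply/setP => e; rewrite !inE.
have [->|] //= := eqVneq e [set l; a]%SET.
by rewrite (negbTE lE) !inE (negbTE vl) eq_sym (negbTE av).
Qed.

(** The degrees show which vertices occur in the code, so both decodings remove the same leaf; its
    only edge gives the first letter. *)
Lemma pruefer_decode_inj c1 c2 S : pruefer_code c1 S -> pruefer_code c2 S ->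
  pruefer_decode c1 S = pruefer_decode c2 S -> c1 = c2.
Proof.
elim: c1 c2 S => [|a1 c1 IH] [|a2 c2] S cS1 cS2 //.
- by case: cS2 => _; case: cS1 => _ ->.
- by case: cS2 => _; case: cS1 => _ ->.
move=> eqd.
have same : S :\: [set x in a1 :: c1] = S :\: [set x in a2 :: c2].
  apply/setP => x; rewrite !in_setD; have [xS|] := boolP (x \in S); last by rewrite !andbF.
  rewrite !andbT !in_set -!has_pred1 !has_count.
  have := pruefer_degree cS1 xS; rewrite eqd (pruefer_degree cS2 xS).
  by move=> [e]; rewrite /= e.
have [l [p1 lS la lc cS1']] := pruefer_code_cons cS1.
have [l' [p2 _ la2 _ cS2']] := pruefer_code_cons cS2.
move: p2; rewrite -same p1 => -[el]; move: la2 cS2'; rewrite -el => la2 cS2' {el l'}.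
move: eqd => /=; rewrite p1; rewrite same in p1; rewrite p1 => eqd.
have ea : [set l; a1]%SET = [set l; a2]%SET.
  by apply/set1_inj; rewrite -(edges_at_leaf a1 cS1') eqd edges_at_leaf.
have ea' : a1 = a2.
  have : a1 \in [set l; a2]%SET by rewrite -ea !inE eqxx orbT.
  by rewrite !inE eq_sym (negbTE la) => /eqP.
rewrite -ea' in eqd *; congr cons; apply: (IH _ _ cS1' cS2').
have rem c : pruefer_code c (S :\ l) -> [set l; a1]%SET \notin pruefer_decode c (S :\ l).
  move=> cS; apply/negP => /(pruefer_decode_sub cS)[/subsetP /(_ l)].
  by rewrite !inE !eqxx => /(_ isT).
by rewrite -(setU1K (rem _ cS1')) eqd setU1K ?rem.
Qed.

(** A cycle through [l] would use two distinct neighbours of [l] other than [l], while [a] is the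
    only candidate. *)
Lemma acyclic_leaf E l a : (forall e, e \in E -> l \notin e) ->
  acyclic E -> acyclic ([set l; a]%SET |: E).
Proof.
move=> lE acE c cs /andP[cyc uc].
have adjl x : adj ([set l; a]%SET |: E) l x -> x = a \/ x = l.
  rewrite /adj /= in_setU1 => /orP[/eqP/setP/(_ x)|/lE].
    by rewrite !inE eqxx orbT => /esym/orP[]/eqP; [right|left].
  by rewrite !inE eqxx.
have adjn x y : x != l -> y != l -> adj ([set l; a]%SET |: E) x y -> adj E x y.
  move=> xl yl; rewrite /adj /= in_setU1 => /orP[/eqP/setP/(_ l)|//].
  by rewrite !inE eqxx eq_sym (negbTE xl) eq_sym (negbTE yl).
have [lc|lc] := boolP (l \in c); last first.
  apply: (acE c cs); apply/andP; split=> //.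
  have adjn' : {in predC1 l &, subrel (adj ([set l; a]%SET |: E)) (adj E)}.
    by move=> x y; rewrite !inE => xl yl; apply: adjn.
  apply: (sub_in_cycle adjn') cyc.
  by apply/allP => x xc /=; apply: contraNneq lc => <-.
have [i c' ec] := rot_to lc.
move: cyc uc cs; rewrite -(rot_cycle i) -(rot_uniq i) -(size_rot i) ec.
case: c' {ec} => [|x c'] //; case/lastP: c' => [|c' y] //.
rewrite /= rcons_path last_rcons => /andP[lx /andP[_ yl]].
have xa : x = a \/ x = l by apply: adjl.
have ya : y = a \/ y = l by apply: adjl; rewrite adj_sym.
rewrite !inE !mem_rcons !inE !negb_or => /andP[/and3P[lx' ly _]] /andP[/andP[xy _] _] _.
case: xa => xa; last by rewrite xa eqxx in lx'.
by case: ya => ya; [rewrite xa ya eqxx in xy|rewrite ya eqxx in ly].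
Qed.

Lemma pruefer_decode_acyclic c S : pruefer_code c S -> acyclic (pruefer_decode c S).
Proof.
elim: c S => [|a c IH] S cS /=.
  move=> [|x [|y [|z c]]] // _ /=.
  rewrite /ucycle /= !inE /adj /= !inE => /andP[/and3P[/eqP xy /eqP yz _]].
  case: cS => _ cS2; move=> /and3P[]; rewrite !negb_or => /and3P[h1 h2 _] /andP[h3 _] _.
  have /setP/(_ z) : [set x; y]%SET = [set y; z]%SET by rewrite xy yz.
  by rewrite !inE eqxx orbT eq_sym (negbTE h2) eq_sym (negbTE h3).
have [l [-> lS la lc cS']] := pruefer_code_cons cS.
apply: acyclic_leaf; last exact: IH.
move=> e /(pruefer_decode_sub cS')[/subsetP sub _].
by apply/negP => /sub; rewrite !inE eqxx.
Qed.

Lemma pruefer_decode_connect c S x y : pruefer_code c S -> x \in S -> y \in S ->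
  connect (adj (pruefer_decode c S)) x y.
Proof.
elim: c S x y => [|a c IH] S x y cS xS yS /=.
  have [->|xy] := eqVneq x y; first exact: connect0.
  apply: connect1; rewrite /adj /= inE eqEcard; case: cS => _ ->.
  by rewrite cards2 xy subUset !sub1set xS yS.
have [l [-> lS la lc cS']] := pruefer_code_cons cS.
set E := _ |: _.
have aS : a \in S :\ l.
  by rewrite !inE eq_sym la; case: cS => -> //; rewrite mem_head.
suff toa z : z \in S -> connect (adj E) z a.
  by apply: connect_trans (toa _ xS) _; rewrite connect_adj_sym toa.
move=> zS; have [->|zl] := eqVneq z l.
  by apply: connect1; rewrite /adj /= !inE eqxx.
apply: connect_mono (IH _ z a cS' _ aS); last by rewrite !inE zl.
by apply: adj_mono; apply: subsetUr.
Qed.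

End Pruefer.

(** The lower half of Cayley's formula: distinct codes of length [n] decode to distinct trees. *)
Lemma leq_card_labelled_trees n : (n.+2 ^ n <= #|labelled_trees n.+2|)%N.
Proof.
have code (t : n.-tuple 'I_n.+2) : pruefer_code t [set: 'I_n.+2].
  by split; [move=> x; rewrite inE|rewrite cardsT card_ord size_tuple].
pose f (t : n.-tuple 'I_n.+2) := pruefer_decode t [set: 'I_n.+2].
have finj : injective f.
  by move=> s t /(pruefer_decode_inj (code s) (code t))/val_inj.
rewrite -[X in (X ^ _)%N]card_ord -card_tuple -(card_codom finj).
apply: subset_leq_card; apply/subsetP => _ /codomP[t ->].
rewrite inE; apply/asboolP; split.
- by apply/forall_inP => e /(pruefer_decode_sub (code t))[_ ->].
- apply/andP; split.
    by apply/set0Pn; exists ord0; rewrite inE.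
  apply/forall_inP => x xT; apply/forall_inP => y yT.
  apply: connect_mono (pruefer_decode_connect (code t) xT yT).
  by move=> u v; rewrite /induced_adj /= !inE.
- exact: pruefer_decode_acyclic (code t).
Qed.

(** * Shapes of forests and sums over labelled forests *)

(* A rooted forest in first-child / next-sibling form: [Node c d] has a first
   tree whose root carries the forest [c], followed by the forest [d].  Then
   [nsub] counts the choices, in each tree, of nothing or a sub-tree through the
   root. *)
Inductive shape := Empty | Node of shape & shape.

Fixpoint nsub (b : shape) : nat :=
  if b is Node c d then ((nsub c).+1 * nsub d)%N else 1%N.

Fixpoint nnodes (b : shape) : nat :=
  if b is Node c d then (nnodes c + nnodes d).+1 else 0%N.

(** Through this a bound on the value bounds the size. *)
Lemma nsub_gt (b : shape) : (nnodes b < nsub b)%N.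
Proof.
by elim: b => [|c IHc d IHd] //=; nia.
Qed.

(** * Normalised sums over labelled forests *)

Section Ex.
Variable R : realType.
Implicit Types u v : shape -> R.

(* The sum of [u] over the labelled forests on n vertices, divided by n!, where
   [k] is fuel; the first tree is the one containing a distinguished vertex. *)
Fixpoint exf (k n : nat) u : R :=
  if k is k'.+1 then
    if n is m.+1 then
      (\sum_(j < m.+1) j.+1%:R *
         exf k' j (fun c => exf k' (m - j) (fun d => u (Node c d)))) / m.+1%:R
    else u Empty
  else 0.

Lemma exf_ext k n u v : u =1 v -> exf k n u = exf k n v.
Proof. by move=> /funext->. Qed.

Lemma exf_le k n u v : (forall b, nnodes b = n -> u b <= v b) ->
  exf k n u <= exf k n v.
Proof.
elim: k n u v => [|k IH] n u v uv; first exact: lexx.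
case: n uv => [|m] uv /=; first exact: uv.
rewrite ler_pM2r ?invr_gt0 ?ltr0n //; apply: ler_sum => j _.
rewrite ler_wpM2l //; apply: (IH) => c cj; apply: (IH) => d dj; apply: uv.
by rewrite /= cj dj subnKC // -ltnS.
Qed.

Lemma exf_sum k n (I : Type) (r : seq I) (P : pred I) (a : I -> R) (u : I -> shape -> R) :
  exf k n (fun b => \sum_(i <- r | P i) a i * u i b) =
  \sum_(i <- r | P i) a i * exf k n (u i).
Proof.
elim: k n u => [|k IH] n u /=.
  by rewrite big1 // => i _; rewrite mulr0.
case: n => [|m] //.
transitivity ((\sum_(j < m.+1) \sum_(i <- r | P i) a i * (j.+1%:R * exf k j
    (fun c => exf k (m - j) (fun d => u i (Node c d))))) / m.+1%:R).
  congr (_ / _); apply: eq_bigr => j _.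
  under exf_ext => c do rewrite IH.
  rewrite IH mulr_sumr; apply: eq_bigr => i _.
  by rewrite mulrCA.
rewrite exchange_big /= mulr_suml; apply: eq_bigr => i _.
by rewrite -mulr_sumr mulrA.
Qed.

Lemma exfZ k n a u : exf k n (fun b => a * u b) = a * exf k n u.
Proof.
have := exf_sum k n [:: tt] xpredT (fun=> a) (fun=> u).
rewrite big_seq1 => <-; apply: exf_ext => b.
by rewrite big_seq1.
Qed.

Lemma exfD k n u v : exf k n (fun b => u b + v b) = exf k n u + exf k n v.
Proof.
have := exf_sum k n [:: true; false] xpredT (fun=> 1) (fun i => if i then u else v).
rewrite !big_cons !big_nil !mul1r addr0 => <-; apply: exf_ext => b.
by rewrite !big_cons big_nil !mul1r addr0.
Qed.

Lemma exfC k n k' n' (u : shape -> shape -> R) :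
  exf k n (fun b => exf k' n' (u b)) =
  exf k' n' (fun b' => exf k n (fun b => u b b')).
Proof.
elim: k n u => [|k IH] n u /=.
  rewrite -[RHS](_ : exf k' n' (fun=> 0 * 0) = _); first by rewrite exfZ mul0r.
  by apply: exf_ext => b; rewrite mulr0.
case: n => [|m] //.
under [RHS]exf_ext => b'.
  rewrite mulr_suml; under eq_bigr => j _ do rewrite mulrAC.
  over.
rewrite exf_sum mulr_suml; apply: eq_bigr => j _.
rewrite mulrAC; congr (_ * _); rewrite -IH.
by apply: exf_ext => c; rewrite IH.
Qed.

Lemma exf_fuel k k' n u : (n < k)%N -> (n < k')%N -> exf k n u = exf k' n u.
Proof.
elim: k k' n u => [|k IH] [|k'] [|m] u //=; rewrite !ltnS => mk mk'.
congr (_ / _); apply: eq_bigr => j _; congr (_ * _).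
have jm : (j <= m)%N by rewrite -ltnS.
rewrite (IH k') ?(leq_ltn_trans jm) //; apply: exf_ext => c.
by apply: IH; apply: leq_ltn_trans (leq_subr _ _) _.
Qed.

Definition ex n := exf n.+1 n.

Lemma ex0 u : ex 0 u = u Empty. Proof. by []. Qed.

(** The tree of the distinguished vertex has j + 1 possible roots; the binomial coefficient for its
    other j vertices is absorbed by the factorials. *)
Lemma exS m u : m.+1%:R * ex m.+1 u = \sum_(j < m.+1) j.+1%:R *
  ex j (fun c => ex (m - j) (fun d => u (Node c d))).
Proof.
have -> : ex m.+1 u = (\sum_(j < m.+1) j.+1%:R * exf m.+1 j
    (fun c => exf m.+1 (m - j) (fun d => u (Node c d)))) / m.+1%:R by [].
rewrite mulrC divfK ?pnatr_eq0 //.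
apply: eq_bigr => j _; congr (_ * _).
have jm : (j <= m)%N by rewrite -ltnS.
rewrite [LHS](@exf_fuel _ j.+1) //; apply: exf_ext => c.
by apply: exf_fuel => //; rewrite ltnS leq_subr.
Qed.

Lemma ex_ext n u v : u =1 v -> ex n u = ex n v.
Proof. exact: exf_ext. Qed.

Lemma ex_sum n (I : Type) (r : seq I) (P : pred I) (a : I -> R) (u : I -> shape -> R) :
  ex n (fun b => \sum_(i <- r | P i) a i * u i b) =
  \sum_(i <- r | P i) a i * ex n (u i).
Proof. exact: exf_sum. Qed.

Lemma exD n u v : ex n (fun b => u b + v b) = ex n u + ex n v.
Proof. exact: exfD. Qed.

Lemma exC n m (u : shape -> shape -> R) :
  ex n (fun b => ex m (u b)) = ex m (fun c => ex n (fun b => u b c)).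
Proof. exact: exfC. Qed.

Lemma exZ n a u : ex n (fun b => a * u b) = a * ex n u.
Proof. exact: exfZ. Qed.

Lemma exZr n a u : ex n (fun b => u b * a) = ex n u * a.
Proof. by rewrite mulrC -exZ; apply: ex_ext => b; rewrite mulrC. Qed.

Lemma ex_le n u v : (forall b, nnodes b = n -> u b <= v b) -> ex n u <= ex n v.
Proof. exact: exf_le. Qed.

Lemma ex_const0 n : ex n (fun=> 0) = 0.
Proof. by rewrite -[X in ex n (fun=> X)](mulr0 0) (exZ n 0 (fun=> 0)) mul0r. Qed.

Lemma ex_ge0 n u : (forall b, nnodes b = n -> 0 <= u b) -> 0 <= ex n u.
Proof. by move=> u0; rewrite -(ex_const0 n); apply: ex_le. Qed.

End Ex.

(** * Enumeration of the forests hanging from a vertex *)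

Section LabelledForests.
Variables (R : realType) (V : finType).
Implicit Types (S A X : {set V}) (E G : {set {set V}}).
Implicit Types u : {set {set V}} -> shape -> R.

(* The sum of [u E b] over the forests on [S] hanging from [r], [E] being the
   edge set and [b] the shape; the tree through the vertex picked in [S] comes
   first, so that every forest is listed once. *)
Fixpoint fsum (k : nat) (r : V) S u : R :=
  if k is k'.+1 then
    if [pick m in S] is Some m then
      \sum_(A in powerset (S :\ m)) \sum_(r' in m |: A)
        fsum k' r' ((m |: A) :\ r') (fun E1 c =>
          fsum k' r (S :\: (m |: A)) (fun E2 d =>
            u ([set r; r']%SET |: (E1 :|: E2)) (Node c d)))
    else u set0 Empty
  else 0.

Lemma fsum_ext k r S u v : (forall E b, u E b = v E b) -> fsum k r S u = fsum k r S v.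
Proof.
by move=> uv; congr (fsum _ _ _ _); apply/funext => E; apply/funext => b.
Qed.

Lemma fsum_le k r S u v : (forall E b, u E b <= v E b) ->
  fsum k r S u <= fsum k r S v.
Proof.
elim: k r S u v => [|k IH] r S u v uv /=; first exact: lexx.
case: pickP => [m _|_]; last exact: uv.
apply: ler_sum => A _; apply: ler_sum => r' _.
by apply: (IH) => E1 c; apply: (IH) => E2 d.
Qed.

Lemma fsum_sum k r S (I : Type) (s : seq I) (P : pred I)
    (u : I -> {set {set V}} -> shape -> R) :
  fsum k r S (fun E b => \sum_(i <- s | P i) u i E b) =
  \sum_(i <- s | P i) fsum k r S (u i).
Proof.
elim: k r S u => [|k IH] r S u /=; first by rewrite big1.
case: pickP => [m _|//].
rewrite exchange_big /=; apply: eq_bigr => A _.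
rewrite exchange_big /=; apply: eq_bigr => r' _.
by under fsum_ext => E1 c do rewrite IH; rewrite IH.
Qed.

Lemma fsumZ k r S a u : fsum k r S (fun E b => a * u E b) = a * fsum k r S u.
Proof.
elim: k r S u => [|k IH] r S u /=; first by rewrite mulr0.
case: pickP => [m _|//].
rewrite mulr_sumr; apply: eq_bigr => A _.
rewrite mulr_sumr; apply: eq_bigr => r' _.
by under fsum_ext => E1 c do rewrite IH; rewrite IH.
Qed.

Lemma fsum_ge0 k r S u : (forall E b, 0 <= u E b) -> 0 <= fsum k r S u.
Proof.
move=> u0; rewrite -(mul0r (fsum k r S u)) -fsumZ; apply: fsum_le => E b.
by rewrite mul0r.
Qed.

Lemma sum_powerset_card (B : {set V}) (g : nat -> R) :
  \sum_(A in powerset B) g #|A| = \sum_(j < #|B|.+1) 'C(#|B|, j)%:R * g j.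
Proof.
rewrite (partition_big (fun A : {set V} => (inord #|A| : 'I_#|B|.+1)) xpredT) //=.
apply: eq_bigr => j _.
rewrite -cards_draws -[X in X%:R * _]sum1_card natr_sum mulr_suml.
have inordE A : A \subset B -> (inord #|A| == j) = (#|A| == j :> nat).
  by move=> AB; rewrite -val_eqE /= inordK // ltnS subset_leq_card.
rewrite (eq_bigl (fun A => A \in [set A : {set V} | A \subset B & #|A| == j])); last first.
  by move=> A; rewrite powersetE !inE; case: (boolP (A \subset B)) => // /inordE.
by apply: eq_bigr => A; rewrite inE mul1r => /andP[_ /eqP->].
Qed.

(** The first tree contributes a binomial coefficient for its j vertices besides [m] and a factor j
    + 1 for its root; with the factorials of the two parts this is the recursion of [exf]. *)
Lemma fsum_shape k r S (u : shape -> R) :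
  fsum k r S (fun _ b => u b) = (#|S|)`!%:R * exf k #|S| u.
Proof.
elim: k r S u => [|k IH] r S u /=; first by rewrite mulr0.
case: pickP => [m mS|S0]; last first.
  have -> : S = set0 by apply/setP => x; rewrite inE; apply: S0.
  by rewrite cards0 mul1r.
have cS : #|S| = #|S :\ m|.+1 by rewrite (cardsD1 m) mS.
set M := #|S :\ m| in cS; rewrite cS.
pose phi j := exf k j (fun c => exf k (M - j) (fun d => u (Node c d))).
transitivity (\sum_(A in powerset (S :\ m))
    (#|A|.+1%:R * ((#|A|)`!%:R * ((M - #|A|)`!%:R * phi #|A|)) : R)).
  apply: eq_bigr => A; rewrite powersetE => AS.
  have mA : m \notin A by apply/negP => /(subsetP AS); rewrite !inE eqxx.
  have cA : #|m |: A| = #|A|.+1 by rewrite cardsU1 mA.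
  have cC : #|S :\: (m |: A)| = (M - #|A|)%N.
    by rewrite -setDDl cardsD (setIidPr AS).
  transitivity (\sum_(r' in m |: A) ((#|A|)`!%:R * ((M - #|A|)`!%:R * phi #|A|))).
    apply: eq_bigr => r' r'A.
    under fsum_ext => E1 c do rewrite IH cC.
    have cA' : #|(m |: A) :\ r'| = #|A|.
      by apply/eqP; rewrite -eqSS -cA (cardsD1 r' (m |: A)) r'A.
    by rewrite (IH _ _ (fun c => _ * exf k _ _)) cA' exfZ.
  by rewrite sumr_const cA [RHS]mulr_natl.
rewrite (sum_powerset_card _ (fun j => j.+1%:R * (j`!%:R * ((M - j)`!%:R * phi j)))).
rewrite -/M factS natrM [M.+1%:R * M`!%:R]mulrC mulrACA divff ?pnatr_eq0 // mulr1.
rewrite mulr_sumr; apply: eq_bigr => j _.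
have jM : (j <= M)%N by rewrite -ltnS.
rewrite -(bin_fact jM) !natrM -/(phi _); ring.
Qed.

(** * Encoding a tree by its shape *)

Definition hangs G r S := forall x, x \in S -> connect (induced_adj G (r |: S)) r x.

Lemma induced_adj_sym G S : symmetric (induced_adj G S).
Proof. by move=> x y; rewrite /induced_adj /= adj_sym andbCA. Qed.

Lemma connect_induced_sym G S : connect_sym (induced_adj G S).
Proof. by apply: sym_connect_sym; apply: induced_adj_sym. Qed.

Lemma induced_adj_mono G S S' : S \subset S' ->
  subrel (induced_adj G S) (induced_adj G S').
Proof.
by move=> /subsetP sS x y /and3P[/sS xS /sS yS xy]; apply/and3P.
Qed.

Lemma closed_connect (e : rel V) (C : {pred V}) x y :
  (forall a b, a \in C -> e a b -> b \in C) -> connect e x y -> x \in C -> y \in C.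
Proof.
move=> cl /connectP[p + ->]; elim: p x => [|z p IH] x //= /andP[xz /IH{}IH] xC.
by apply: IH; apply: cl xz.
Qed.

(** Here [m |: A] is the component of [m] in the graph induced on [S]. A path from [r] enters it at
    some [r'], and the rest of [S] is reached from [r] without crossing it. *)
Lemma hangs_split G r S m : r \notin S -> m \in S -> hangs G r S ->
  exists A r', [/\ A \subset S :\ m, r' \in m |: A, adj G r r',
    hangs G r' ((m |: A) :\ r') & hangs G r (S :\: (m |: A))].
Proof.
move=> rS mS hS.
pose C := [set x in S | connect (induced_adj G S) m x].
have mC : m \in C by rewrite inE mS connect0.
have CE : m |: C :\ m = C by rewrite setD1K.
have CS : C \subset S by apply/subsetP => x; rewrite inE => /andP[].
have Ccl x y : x \in C -> y \in S -> adj G x y -> y \in C.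
  rewrite !inE => /andP[xS mx] yS xy; rewrite yS (connect_trans mx) //.
  by apply: connect1; apply/and3P.
have [r' r'C rr'] : exists2 r', r' \in C & adj G r r'.
  apply/exists_inP; apply: contraT; rewrite negb_exists_in => /forall_inP no.
  suff : r \in C by move=> /(subsetP CS); rewrite (negbTE rS).
  have : connect (induced_adj G (r |: S)) m r by rewrite connect_induced_sym hS.
  move/(@closed_connect _ (mem C)); apply=> // a b aC /and3P[_ + ab].
  rewrite in_setU1 => /orP[/eqP br|bS]; last exact: Ccl ab.
  by have := no _ aC; rewrite adj_sym -br ab.
exists (C :\ m), r'; rewrite CE; split=> //.
- by apply: setSD.
- move=> x; rewrite setD1K // in_setD1 => /andP[_ xC].
  suff mto y : y \in C -> connect (induced_adj G C) m y.
    by rewrite (connect_trans _ (mto _ xC)) // connect_induced_sym mto.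
  rewrite inE => /andP[yS my].
  pose D := [set z in C | connect (induced_adj G C) m z].
  suff : y \in D by rewrite inE => /andP[].
  apply: (@closed_connect _ (mem D)) my _; last by rewrite inE mC connect0.
  move=> a b; rewrite inE => /andP[aC ma] /and3P[aS bS ab].
  have bC : b \in C by apply: Ccl ab.
  by rewrite inE bC (connect_trans ma) //; apply: connect1; apply/and3P.
- move=> x; rewrite inE => /andP[xC xS].
  rewrite connect_induced_sym; set Q := r |: _.
  pose D := [set z in Q | connect (induced_adj G Q) x z].
  have xQ : x \in Q by rewrite in_setU1 in_setD xS xC orbT.
  (* If [r] is not reached, the part reached from [x] avoids [r] and the component of [m], so it is
     closed even in [r |: S], and the path to [r] ends in it. *)
  have [rD|rD] := boolP (r \in D); first by move: rD; rewrite inE => /andP[].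
  suff : r \in D by rewrite (negbTE rD).
  have : connect (induced_adj G (r |: S)) x r by rewrite connect_induced_sym hS.
  move/(@closed_connect _ (mem D)); apply=> /=; last by rewrite inE xQ connect0.
  move=> a b aD /and3P[_ bS ab].
  have aQ : a \in Q by move: aD; rewrite inE => /andP[].
  have aC : a \notin C.
    move: aQ; rewrite in_setU1 => /orP[/eqP ar|]; last by rewrite inE => /andP[].
    by rewrite -ar aD in rD.
  have aS : a \in S.
    move: aQ; rewrite in_setU1 => /orP[/eqP ar|]; last by rewrite inE => /andP[].
    by rewrite -ar aD in rD.
  have bQ : b \in Q.
    move: bS; rewrite !in_setU1 => /orP[->//|bS]; apply/orP; right.
    rewrite inE bS andbT; apply: contra aC => bC; apply: Ccl bC aS _.
    by rewrite adj_sym.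
  move: aD; rewrite 2!inE => /andP[_ xa]; rewrite inE bQ /=.
  by rewrite (connect_trans xa) //; apply: connect1; apply/and3P.
Qed.

Definition hanging_family G r S (F : {set {set V}}) :=
  forall X, X \in F -> X \subset S /\ hangs G r X.

(** Either nothing, or [r'] with a member of [F1], is joined to a member of [F2]. This mirrors the
    recursion of [nsub]; [A] separates the two parts, so the union is injective. *)
Lemma hanging_family_node G r r' A S F1 F2 :
  r' \in A -> A \subset S -> adj G r r' ->
  hanging_family G r' (A :\ r') F1 -> hanging_family G r (S :\: A) F2 ->
  exists F, hanging_family G r S F /\ #|F| = (#|F1|.+1 * #|F2|)%N.
Proof.
move=> r'A AS rr' h1 h2.
pose F1' := set0 |: [set r' |: X | X in F1].
have F1A X : X \in F1' -> X \subset A.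
  rewrite in_setU1 => /orP[/eqP->|/imsetP[Y /h1[YA _] ->]]; first exact: sub0set.
  by rewrite subUset sub1set r'A (subset_trans YA) // subsetDl.
exists [set p.1 :|: p.2 | p in setX F1' F2]; split.
  move=> _ /imsetP[[X1 X2] /setXP[/= X1F X2F] ->].
  have [X2S hX2] := h2 _ X2F; split.
    by rewrite subUset (subset_trans (F1A _ X1F) AS) (subset_trans X2S) // subsetDl.
  move=> x; rewrite inE => /orP[xX1|xX2]; last first.
    apply: connect_mono (hX2 _ xX2); apply: induced_adj_mono.
    by rewrite setUS // subsetUr.
  move: X1F; rewrite in_setU1 => /orP[/eqP X10|/imsetP[Y /h1[YA hY] eX1]].
    by rewrite X10 inE in xX1.
  apply: (@connect_trans _ _ r').
    by apply: connect1; apply/and3P; rewrite eX1 !inE !eqxx ?orbT.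
  move: xX1; rewrite eX1 in_setU1 => /orP[/eqP->|xY]; first exact: connect0.
  apply: connect_mono (hY _ xY); apply: induced_adj_mono.
  by apply/subsetP => z; rewrite !inE => ->; rewrite orbT.
rewrite card_in_imset => [|[X1 X2] [Y1 Y2]].
  rewrite cardsX; congr (_ * _)%N; rewrite cardsU1 card_in_imset.
    rewrite (_ : _ \notin _) //; apply/negP => /imsetP[X _ /setP/(_ r')].
    by rewrite !inE eqxx.
  move=> X Y /h1[XA _] /h1[YA _] /(congr1 (fun Z => Z :\ r')).
  have notin (Z : {set V}) : Z \subset A :\ r' -> r' \notin Z.
    by move=> ZA; apply/negP => /(subsetP ZA); rewrite !inE eqxx.
  by rewrite !setU1K ?notin.
have keyA X Y : X \in F1' -> Y \in F2 -> (X :|: Y) :&: A = X.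
  move=> /F1A XA /h2[/subsetP YA _]; apply/setP => x; rewrite !inE.
  have [/(subsetP XA)->|xX] //= := boolP (x \in X).
  by apply/negP => /andP[/YA]; rewrite inE => /andP[/negP].
have keyB X Y : X \in F1' -> Y \in F2 -> (X :|: Y) :\: A = Y.
  move=> /F1A XA /h2[/subsetP YA _]; apply/setP => x; rewrite !inE.
  have [/YA|xY] := boolP (x \in Y); first by rewrite inE orbT => /andP[->].
  by rewrite orbF; apply/negP => /andP[/negP xA /(subsetP XA)].
move=> /setXP[/= X1F X2F] /setXP[/= Y1F Y2F] e; congr pair.
  by rewrite -(keyA _ _ X1F X2F) e keyA.
by rewrite -(keyB _ _ X1F X2F) e keyB.
Qed.

(** Recursion along [hangs_split]. The last clause expresses that the pair of [E] and [b] is a term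
    of the enumeration, the others being nonnegative. *)
Lemma fsum_encode k r S G : r \notin S -> (#|S| < k)%N -> hangs G r S ->
  exists E b F, [/\ E \subset G, (forall x, x \in S -> connect (adj E) r x),
    hanging_family G r S F, #|F| = nsub b &
    forall u, (forall E b, 0 <= u E b) -> u E b <= fsum k r S u].
Proof.
elim: k r S => [|k IH] r S rS Sk hS //.
rewrite /=; case: pickP => [m mS|S0]; last first.
  exists set0, Empty, [set set0]; split=> //.
  - exact: sub0set.
  - by move=> x; rewrite (S0 x).
  - move=> X; rewrite inE => /eqP->; split; first exact: sub0set.
    by move=> x; rewrite inE.
  - by rewrite cards1.
have [A [r' [AS r'A rr' h1 h2]]] := hangs_split rS mS hS.
have mAS : m |: A \subset S.
  by rewrite subUset sub1set mS (subset_trans AS) // subsetDl.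
have c1 : (#|(m |: A) :\ r'| < k)%N.
  apply: leq_trans (_ : #|m |: A| <= _)%N; first by rewrite [in X in (_ < X)%N](cardsD1 r') r'A.
  by rewrite -ltnS (leq_ltn_trans _ Sk) // subset_leq_card.
have c2 : (#|S :\: (m |: A)| < k)%N.
  rewrite -ltnS (leq_trans _ Sk) // ltnS; apply: proper_card.
  rewrite properE subsetDl /=; apply/negP => /subsetP /(_ m mS).
  by rewrite !inE eqxx.
have [|E1 [b1 [F1 [E1G con1 fam1 card1 u1]]]] := IH r' _ _ c1 h1.
  by rewrite !inE eqxx.
have [|E2 [b2 [F2 [E2G con2 fam2 card2 u2]]]] := IH r _ _ c2 h2.
  by rewrite inE (negbTE rS) andbF.
have [F [famF cardF]] := hanging_family_node r'A mAS rr' fam1 fam2.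
exists ([set r; r']%SET |: (E1 :|: E2)), (Node b1 b2), F; split=> //.
- by rewrite !subUset sub1set E1G E2G !andbT.
- move=> x xS; have [xA|xA] := boolP (x \in m |: A); last first.
    apply: connect_mono (con2 x _); last by rewrite inE xA.
    by apply: adj_mono; rewrite setUA subsetUr.
  apply: (@connect_trans _ _ r'); first by apply: connect1; rewrite /adj /= !inE eqxx.
  have [->|xr'] := eqVneq x r'; first exact: connect0.
  apply: connect_mono (con1 x _); last by rewrite in_setD1 xr'.
  by apply: adj_mono; rewrite setUCA subsetUl.
- by rewrite cardF card1 card2.
move=> u u0.
rewrite (bigD1 A) ?powersetE //= (bigD1 r') //=.
have ge0 B s : 0 <= fsum k s ((m |: B) :\ s) (fun E1 c =>
    fsum k r (S :\: (m |: B)) (fun E2 d =>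
      u ([set r; s]%SET |: (E1 :|: E2)) (Node c d))).
  by apply: fsum_ge0 => *; apply: fsum_ge0.
apply: le_trans (u2 (fun E2 d => u ([set r; r']%SET |: (E1 :|: E2)) (Node b1 d)) _) _ => //.
apply: le_trans (u1 (fun E1 c => fsum k r (S :\: (m |: A)) (fun E2 d =>
      u ([set r; r']%SET |: (E1 :|: E2)) (Node c d))) _) _.
  by move=> *; apply: fsum_ge0.
rewrite -addrA lerDl addr_ge0 //; first by apply: sumr_ge0.
by apply: sumr_ge0 => B _; apply: sumr_ge0.
Qed.

(** An edge of [G] from x to y closes a path of [E] to a cycle of [G], unless the path is that edge
    itself. *)
Lemma acyclic_spanning_sub E G x y : E \subset G -> simple_graph G -> acyclic G ->
  (forall x y, connect (adj E) x y) -> [set x; y]%SET \in G -> [set x; y]%SET \in E.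
Proof.
move=> EG sG acG conE xyG.
have xy : x != y.
  by have /forall_inP/(_ _ xyG) := sG; rewrite cards2; case: (x != y).
have /connectP[p pth] := conE x y; case/shortenP: pth => p' pth up _ {p} ey.
have pthG : path (adj G) x p' by apply: sub_path pth; apply: adj_mono.
case: p' => [|z [|w p']] in pth pthG up ey *.
- by rewrite /= ey eqxx in xy.
- by move: pth; rewrite /= andbT ey.
exfalso; apply: (acG (x :: z :: w :: p')) => //; apply/andP; split=> //.
change (path (adj G) x (rcons [:: z, w & p'] x)).
by rewrite rcons_path pthG -ey adj_sym; apply: xyG.
Qed.

End LabelledForests.

(** The tree is rooted at [ord0]. The encoded edge set is connected, spanning and contained in [T],
    hence is [T]; the family gives sub-trees through the root. *)
Lemma tree_encode (R : realType) n (T : {set {set 'I_n.+1}}) : is_tree T ->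
  exists2 b, (nsub b <= #|subtrees T|)%N & forall W : shape -> R,
    (forall b, 0 <= W b) ->
    W b <= fsum n.+1 ord0 [set~ ord0] (fun E c => (E == T)%:R * W c).
Proof.
case=> sT /andP[_ /forall_inP cT] aT.
have conT x y : connect (induced_adj T setT) x y.
  by have /forall_inP := cT x (in_setT _); apply; rewrite in_setT.
have rE : ord0 |: [set~ ord0] = [set: 'I_n.+1].
  by apply/setP => x; rewrite !inE orbN.
have cS : #|[set~ (ord0 : 'I_n.+1)]| = n by rewrite cardsC1 card_ord.
have [|||E [b [F [ET conE famF cF uE]]]] :=
    @fsum_encode R _ n.+1 ord0 [set~ ord0] T.
- by rewrite !inE eqxx.
- by rewrite cS.
- by move=> x _; rewrite rE.
have conE' x y : connect (adj E) x y.
  suff toy z : connect (adj E) ord0 z.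
    by apply: connect_trans (toy y); rewrite connect_adj_sym.
  have [->|z0] := eqVneq z ord0; first exact: connect0.
  by apply: conE; rewrite !inE.
have {}ET : E = T.
  apply/eqP; rewrite eqEsubset ET; apply/subsetP => e eT.
  have /cards2P[x [y [_ exy]]] : #|e| == 2%N by have /forall_inP/(_ e eT) := sT.
  by rewrite exy in eT *; apply: acyclic_spanning_sub ET sT aT conE' eT.
exists b => [|W W0]; last first.
  have := uE (fun E c => (E == T)%:R * W c); rewrite ET eqxx mul1r; apply.
  by move=> *; rewrite mulr_ge0.
have notin (X : {set 'I_n.+1}) : X \in F -> ord0 \notin X.
  by move=> /famF[/subsetP sX _]; apply/negP => /sX; rewrite !inE eqxx.
rewrite -cF -(@card_in_imset _ _ (fun X => ord0 |: X)); last first.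
  by move=> X Y XF YF /(congr1 (fun Z => Z :\ ord0)); rewrite !setU1K ?notin.
apply: subset_leq_card; apply/subsetP => _ /imsetP[X /famF[_ hX] ->].
rewrite inE; apply/andP; split; first by apply/set0Pn; exists ord0; rewrite !inE.
have to0 x : x \in ord0 |: X -> connect (induced_adj T (ord0 |: X)) ord0 x.
  by rewrite in_setU1 => /orP[/eqP->|/hX//]; apply: connect0.
apply/forall_inP => x /to0 xX; apply/forall_inP => y /to0 yX.
by apply: connect_trans yX; rewrite connect_induced_sym.
Qed.

(** Markov's inequality: a tree with fewer than [y] sub-trees has a shape of weight at least 1, and
    the indicators [E == T] give each tree its own terms. The forest below the root has n
    vertices. *)
Lemma card_trees_le (R : realType) n (y : R) (W : shape -> R) :
  (forall b, 0 <= W b) -> (forall b, (nsub b)%:R < y -> 1 <= W b) ->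
  #|[set T in labelled_trees n.+1 | #|subtrees T|%:R < y]|%:R <=
    n`!%:R * ex n W.
Proof.
move=> W0 W1; set B := [set T in _ | _].
have cS : #|[set~ (ord0 : 'I_n.+1)]| = n by rewrite cardsC1 card_ord.
have := @fsum_shape R _ n.+1 (ord0 : 'I_n.+1) [set~ ord0] W; rewrite cS /ex => <-.
apply: (@le_trans _ _ (fsum n.+1 ord0 [set~ ord0]
    (fun E c => \sum_(T in B) (E == T)%:R * W c))).
  rewrite fsum_sum -sum1_card natr_sum; apply: ler_sum => T.
  rewrite inE inE => /andP[/asboolP isT' lty].
  have [b bT /(_ W W0)] := tree_encode R isT'; apply: le_trans; apply: W1.
  by apply: le_lt_trans lty; rewrite ler_nat.
apply: fsum_le => E b; rewrite -mulr_suml -[leRHS]mul1r ler_wpM2r //.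
have [EB|EB] := boolP (E \in B).
  by rewrite (bigD1 E) //= eqxx big1 ?addr0 // => T /andP[_ /negbTE]; rewrite eq_sym => ->.
rewrite big1 // => T TB; case: eqP => // ET; by rewrite ET TB in EB.
Qed.

(** * Generating functions *)

Section ExponentialFormula.
Variable R : realType.

Lemma derive_le0_le (f df : R -> R) (a b : R) : a <= b ->
  (forall x, a <= x <= b -> is_derive x 1 f (df x)) ->
  (forall x, a < x < b -> df x <= 0) -> f b <= f a.
Proof.
move=> ab fdf df0.
have fdf' x : x \in `]a, b[%R -> is_derive x 1 f (df x).
  by rewrite in_itv /= => /andP[ax xb]; apply: fdf; rewrite !ltW.
apply: (@ler0_derive1_le_cc R f a b) => //; rewrite ?in_itv /= ?lexx ?ab //.
- by move=> x /fdf' [].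
- by move=> x xab; rewrite derive1E; have [_ ->] := fdf' _ xab; apply: df0; rewrite in_itv in xab.
- apply: derivable_within_continuous => x; rewrite in_itv /= => xab.
  by have [] := fdf _ xab.
Qed.

Lemma horner_ge0 (p : {poly R}) x : (forall i, 0 <= p`_i) -> 0 <= x -> 0 <= p.[x].
Proof.
move=> p0 x0; rewrite horner_coef; apply: sumr_ge0 => i _.
by rewrite mulr_ge0 ?exprn_ge0.
Qed.

(** The first hypothesis is A' <= T' A coefficientwise, so A exp (-T) is nonincreasing on [0, x],
    and it starts at 1. *)
Lemma horner_le_expR (A T : {poly R}) x :
  (forall i, 0 <= (T^`() * A - A^`())`_i) -> A.[0] = 1 -> T.[0] = 0 -> 0 <= x ->
  A.[x] <= expR T.[x].
Proof.
move=> pos A0 T0 x0.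
pose g y : R := A.[y] * expR (- T.[y]).
have : g x <= g 0.
  apply: (@derive_le0_le g (fun y => - (T^`() * A - A^`()).[y] * expR (- T.[y]))) => //.
    move=> y _; have h1 := is_derive_poly A y; have h2 := is_derive_poly T y.
    apply: is_derive_eq.
    rewrite !hornerE /GRing.scale /=; ring.
  move=> y /andP[y0 _]; rewrite mulNr oppr_le0 mulr_ge0 ?expR_ge0 //.
  by apply: horner_ge0 => //; apply: ltW.
rewrite /g A0 T0 oppr0 expR0 mulr1 expRN.
by rewrite ler_pdivrMr ?expR_gt0 // mul1r.
Qed.

(** The recursion is A' = T' A for the full series. Truncation keeps A' <= T' A: below degree N no
    term is lost, and from degree N on A' has no coefficient. *)
Lemma partial_sum_le_expR (a t : nat -> R) N x :
  (forall n, 0 <= a n) -> (forall n, 0 <= t n) -> a 0%N = 1 ->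
  (forall m, m.+1%:R * a m.+1 = \sum_(j < m.+1) j.+1%:R * t j * a (m - j)%N) ->
  0 <= x ->
  \sum_(n < N.+1) a n * x ^+ n <= expR (\sum_(j < N) t j * x ^+ j.+1).
Proof.
move=> a0 t0 a1 rec x0.
pose A := \poly_(n < N.+1) a n.
pose T := \poly_(n < N.+1) (if n is j.+1 then t j else 0).
have -> : \sum_(n < N.+1) a n * x ^+ n = A.[x] by rewrite horner_poly.
have -> : \sum_(j < N) t j * x ^+ j.+1 = T.[x].
  by rewrite horner_poly big_ord_recl mul0r add0r.
apply: horner_le_expR => //; first last.
- by rewrite horner_coef0 coef_poly.
- by rewrite horner_coef0 coef_poly a1.
have T0 i : 0 <= T^`()`_i.
  by rewrite coef_deriv mulrn_wge0 // coef_poly; case: ifP.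
have A0 i : 0 <= A`_i by rewrite coef_poly; case: ifP.
move=> m; rewrite coefB coefM coef_deriv subr_ge0 coef_poly ltnS.
have [mN|_] := ltnP m N; last first.
  by rewrite mul0rn; apply: sumr_ge0 => j _; rewrite mulr_ge0.
rewrite -mulr_natl rec; apply: ler_sum => j _.
have jm : (j <= m)%N by rewrite -ltnS.
rewrite coef_deriv !coef_poly ltnS (leq_ltn_trans jm mN).
rewrite ltnS (leq_trans (leq_subr _ _)) ?(ltnW mN) //.
by rewrite mulr_natl.
Qed.

End ExponentialFormula.

(** * Weighted forests and the exponential moment *)

Section WeightedForests.
Variable R : realType.

Section Weight.
Variable theta : nat -> R.

(** As [nsub c] is the value f at the root above [c], this is the product of [theta] at f(v) over
    all vertices v. *)
Fixpoint weight (b : shape) : R :=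
  if b is Node c d then theta (nsub c) * weight c * weight d else 1.

Hypothesis theta_ge0 : forall f, 0 <= theta f.

Lemma weight_ge0 b : 0 <= weight b.
Proof. by elim: b => //= c IHc d IHd; rewrite !mulr_ge0. Qed.

Lemma ex_weight_rec m : m.+1%:R * ex m.+1 weight =
  \sum_(j < m.+1) j.+1%:R * ex j (fun c => theta (nsub c) * weight c) *
    ex (m - j) weight.
Proof.
rewrite exS; apply: eq_bigr => j _; rewrite -mulrA -exZr; congr (_ * _).
by apply: ex_ext => c; rewrite -exZ.
Qed.

(** The truncated exponential formula: a tree on j + 1 vertices is a root with a forest on the other
    j, and the j + 1 choices of root cancel against the factorial. *)
Lemma ex_weight_sum_le N x : 0 <= x ->
  \sum_(n < N.+1) ex n weight * x ^+ n <=
  expR (\sum_(j < N) ex j (fun c => theta (nsub c) * weight c) * x ^+ j.+1).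
Proof.
apply: (partial_sum_le_expR _ (a := fun n => ex n weight)
  (t := fun j => ex j (fun c => theta (nsub c) * weight c))).
- by move=> n; apply: ex_ge0 => b _; apply: weight_ge0.
- by move=> n; apply: ex_ge0 => b _; rewrite mulr_ge0 ?weight_ge0.
- by rewrite ex0.
- exact: ex_weight_rec.
Qed.

End Weight.

Definition nforests n : R := ex n (fun=> 1).

Lemma nforests_gt0 n : 0 < nforests n.
Proof.
elim/ltn_ind: n => -[|m] IH; first by rewrite /nforests ex0.
rewrite -(pmulr_rgt0 _ (ltr0Sn R m)) /nforests exS (bigD1 ord_max) //=.
rewrite ltr_wpDr //.
  apply: sumr_ge0 => j _; rewrite mulr_ge0 //; apply: ex_ge0 => b _.
  by apply: ex_ge0.
by rewrite subnn mulr_gt0 //; apply: (IH m (ltnSn m)).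
Qed.

(** At x = 1/e the bound e reproduces itself: if one partial sum is at most e, the next is at most
    exp (e / e) = e. *)
Lemma nforests_sum_le N : \sum_(n < N.+1) nforests n * expR (-1) ^+ n <= expR 1.
Proof.
have w1 n : ex n (weight (fun=> 1)) = nforests n.
  by apply: ex_ext; elim=> //= c -> d ->; rewrite !mulr1.
elim: N => [|N IH].
  by rewrite big_ord1 /nforests ex0 mul1r expr0 -[leLHS]expR0 ler_expR.
under eq_bigr => n _ do rewrite -w1.
apply: le_trans (ex_weight_sum_le _ _ (expR_ge0 _)) _ => //.
rewrite ler_expR.
under eq_bigr => j _.
  rewrite (ex_ext _ (fun c => mul1r (weight (fun=> 1) c))) w1 exprSr mulrA.
  over.
rewrite -mulr_suml; apply: le_trans (_ : expR 1 * expR (-1) <= 1).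
  by rewrite ler_pM2r ?expR_gt0.
by rewrite expRxMexpNx_1.
Qed.

Definition toll (C f : nat) : R :=
  if (f <= C)%N then ln f.+1%:R - ln f%:R else 0.

Definition tilt (C : nat) (s : R) f := expR (- (s * toll C f)).

Lemma nsub_gt0 b : (0 < nsub b)%N.
Proof. exact: leq_ltn_trans (nsub_gt b). Qed.

Lemma toll_ge0 C f : (0 < f)%N -> 0 <= toll C f.
Proof.
by move=> f0; rewrite /toll; case: ifP => // _; rewrite subr_ge0 ler_ln ?posrE ?ltr0n ?ler_nat.
Qed.

Lemma toll_le1 C f : (0 < f)%N -> toll C f <= 1.
Proof.
move=> f0; rewrite /toll; case: ifP => // _.
rewrite -ln_div ?posrE ?ltr0n // -natr1 mulrDl divff ?pnatr_eq0 -?lt0n // mul1r.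
apply: le_trans (le_ln1Dx _) _.
  by rewrite (lt_le_trans (ltrN10 _)) ?invr_ge0.
by rewrite invf_le1 ?ltr0n // ler1n.
Qed.

(** A tree of value f contributes f + 1 to the product, and [tilt C s f] times f^(-s) equals (f +
    1)^(-s) for f <= C and is at least that beyond. *)
Lemma weight_ge_expR C s b : 0 <= s ->
  expR (- (s * ln (nsub b)%:R)) <= weight (tilt C s) b.
Proof.
move=> s0; elim: b => [|c IHc d IHd] /=; first by rewrite ln1 mulr0 oppr0 expR0.
have c0 := nsub_gt0 c; have d0 := nsub_gt0 d.
rewrite natrM lnM ?posrE ?ltr0n // mulrDr opprD expRD.
rewrite ler_pM ?expR_ge0 //; apply: le_trans (_ : tilt C s (nsub c) *
  expR (- (s * ln (nsub c)%:R)) <= _); last by rewrite ler_wpM2l ?expR_ge0.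
rewrite /tilt -expRD ler_expR -opprD lerN2 -mulrDr ler_wpM2l //.
rewrite /toll; case: ifP => _; first by rewrite subrK.
by rewrite add0r ler_ln ?posrE ?ltr0n ?ler_nat.
Qed.

Lemma weight_le1 C s b : 0 <= s -> weight (tilt C s) b <= 1.
Proof.
move=> s0; have tge0 f : 0 <= tilt C s f by apply: expR_ge0.
elim: b => //= c IHc d IHd.
rewrite mulr_ile1 ?mulr_ge0 ?weight_ge0 //.
rewrite mulr_ile1 ?weight_ge0 //.
by rewrite /tilt expR_le1 oppr_le0 mulr_ge0 ?toll_ge0 ?nsub_gt0.
Qed.

Definition fcount (n f : nat) : R := ex n (fun b => (nsub b == f)%:R).

(* Since [f] bounds the size, for f <= C no term is cut off: this is the
   probability that a Poisson(1) Galton-Watson tree has the value [f]. *)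
Definition fprob (C f : nat) : R :=
  \sum_(j < C) expR (-1) ^+ j.+1 * fcount j f.

Definition mean_toll C : R := \sum_(1 <= f < C.+1) fprob C f * (ln f.+1%:R - ln f%:R).

(** For y = s ln (1 + 1/f) <= s one has 1 - exp (-y) >= y (1 - y), and f^(-s) >= 1 - s ln f >= 1 - s
    C. *)
Lemma tilt_gain C s f : (0 < f <= C)%N -> 0 <= s -> s * C.+1%:R <= 1 ->
  s * (1 - s * C.+1%:R) * (ln f.+1%:R - ln f%:R) <=
  (1 - tilt C s f) * expR (- (s * ln f%:R)).
Proof.
move=> /andP[f0 fC] s0 sC.
have t0 := toll_ge0 C f0; have t1 := toll_le1 C f0.
have -> : ln f.+1%:R - ln f%:R = toll C f by rewrite /toll fC.
set y := s * toll C f; rewrite /tilt -/y.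
have y0 : 0 <= y by rewrite mulr_ge0.
have ys : y <= s by rewrite -[leRHS]mulr1 ler_wpM2l.
have lf : ln f%:R <= C%:R :> R.
  by apply: (@le_trans _ _ f%:R); rewrite ?ler_nat // ltW // ln_sublinear // ltr0n.
have slf : s * ln f%:R <= s * C%:R by rewrite ler_wpM2l.
have e1 : 1 - s * C%:R <= expR (- (s * ln f%:R)).
  by apply: le_trans (expR_ge1Dx _); rewrite lerD2l lerN2.
have e2 : y * (1 - y) <= 1 - expR (- y).
  rewrite expRN; have ey := expR_ge1Dx y.
  have : (expR y)^-1 <= (1 + y)^-1 by rewrite lef_pV2 // posrE ?expR_gt0 //; lra.
  have : (1 + y)^-1 * (1 + y) = 1 by rewrite mulVf //; apply/eqP; lra.
  set z := (1 + y)^-1 => zy ez; suff : z <= 1 - y + y ^+ 2 by rewrite expr2; lra.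
  have z0 : 0 <= z by rewrite invr_ge0; lra.
  have -> : z = z * (1 + y) * (1 - y + y ^+ 2) - z * y ^+ 3 by ring.
  by rewrite zy mul1r gerBl mulr_ge0 // exprn_ge0.
move: sC; rewrite -natr1 mulrDr mulr1 => sC.
have sC0 : 0 <= s * C%:R by rewrite mulr_ge0.
apply: le_trans (_ : y * (1 - y) * (1 - s * C%:R) <= _); last first.
  rewrite ler_pM //; first by rewrite mulr_ge0 //; lra.
  by lra.
rewrite mulrAC -/y -mulrA ler_wpM2l //.
have : 0 <= y * (s * C%:R) by rewrite mulr_ge0.
by nra.
Qed.

(** The partial sums A_N of the weighted forest series at x = exp (-1 + d) stay below exp (1 - d),
    by induction from N = C; the term of index N gives the bound. *)
Lemma ex_weight_bound C (c : R) : 0 <= c -> c < mean_toll C ->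
  exists s d : R, [/\ 0 < s, s * c < d & forall N, (C <= N)%N ->
    ex N (weight (tilt C s)) <= expR ((1 - d) * N.+1%:R)].
Proof.
move=> c0; set mu := mean_toll C => cmu.
have mu0 : 0 < mu by apply: le_lt_trans cmu.
(* The term of index C + 1 in [nforests_sum_le] is e * eta, so the partial sum up to C stays below e
   by that much. *)
pose eta := nforests C.+1 * expR (-1) ^+ C.+2.
have eta0 : 0 < eta by rewrite mulr_gt0 ?nforests_gt0 ?exprn_gt0 ?expR_gt0.
have gap : \sum_(n < C.+1) nforests n * expR (-1) ^+ n <= expR 1 * (1 - eta).
  have := nforests_sum_le C.+1; rewrite big_ord_recr /= -lerBrDr => /le_trans; apply.
  rewrite mulrBr mulr1 lerD2l lerN2 /eta [expR (-1) ^+ C.+2]exprS mulrCA.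
  by rewrite (mulrA (expR 1)) expRxMexpNx_1 mul1r.
(* The first bound gives d (C + 1) <= eta; the second keeps d / s within (mu - c) / 2 of mu, whence
   s c < d. *)
pose s := Num.min (eta / (C.+1%:R * mu)) ((mu - c) / (2 * mu * C.+1%:R)).
have C0 : 0 < C.+1%:R :> R by rewrite ltr0n.
have s0 : 0 < s.
  rewrite lt_min; apply/andP; split.
    by apply: divr_gt0 => //; apply: mulr_gt0.
  by apply: divr_gt0; rewrite ?subr_gt0 // !mulr_gt0 ?ltr0n.
have s1 : s * (C.+1%:R * mu) <= eta.
  by rewrite -ler_pdivlMr ?mulr_gt0 // ge_min lexx.
have s2 : s * C.+1%:R * mu <= (mu - c) / 2.
  have : s * (2 * mu * C.+1%:R) <= mu - c.
    by rewrite -ler_pdivlMr ?mulr_gt0 ?ltr0n // ge_min lexx orbT.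
  by lra.
have sC : s * C.+1%:R <= 1.
  rewrite -(ler_pM2r mu0); apply: le_trans s2 _; lra.
pose d := s * (1 - s * C.+1%:R) * mu.
exists s, d; split=> //.
  rewrite /d -mulrA ltr_pM2l // mulrBl mul1r; lra.
have dE : d * C.+1%:R <= eta.
  apply: le_trans s1; rewrite /d (_ : _ * C.+1%:R =
    s * (C.+1%:R * mu) * (1 - s * C.+1%:R)); last by ring.
  by rewrite -[leRHS]mulr1 ler_wpM2l ?gerBl ?mulr_ge0 // ltW.
have d0 : 0 <= d by rewrite /d !mulr_ge0 ?subr_ge0 // ltW.
set th := tilt C s; have th0 f : 0 <= th f by apply: expR_ge0.
have th1 f : (0 < f)%N -> th f <= 1.
  by move=> f0; rewrite /th /tilt expR_le1 oppr_le0 mulr_ge0 ?toll_ge0 // ltW.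
pose x := expR (-1 + d); have x0 : 0 <= x by apply: expR_ge0.
pose A N := \sum_(n < N.+1) ex n (weight th) * x ^+ n.
pose P N := \sum_(j < N) ex j (fun b => (1 - th (nsub b)) * weight th b) * x ^+ j.+1.
(* Here x >= 1/e, and [tilt_gain] applied value by value produces [mean_toll]. *)
have PC : d <= P C.
  apply: le_trans (_ : \sum_(j < C) expR (-1) ^+ j.+1 * ex j (fun b =>
      \sum_(1 <= f < C.+1) (s * (1 - s * C.+1%:R) * (ln f.+1%:R - ln f%:R)) *
         (nsub b == f)%:R) <= _).
    under eq_bigr => j _ do rewrite ex_sum mulr_sumr.
    rewrite exchange_big /= /d /mu /mean_toll mulr_sumr le_eqVlt; apply/orP; left; apply/eqP.
    apply: eq_bigr => f _; rewrite /fprob /fcount mulrCA mulr_suml.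
    by apply: eq_bigr => j _; rewrite -[LHS]mulrA [X in _ = _ * X]mulrC.
  apply: ler_sum => j _; rewrite [leRHS]mulrC; apply: ler_pM.
  - by rewrite exprn_ge0 ?expR_ge0.
  - apply: ex_ge0 => b _; rewrite big_nat_cond; apply: sumr_ge0 => f /andP[/andP[f0 fC] _].
    rewrite mulr_ge0 // mulr_ge0 //; first by rewrite mulr_ge0 ?subr_ge0 // ltW.
    by rewrite subr_ge0 ler_ln ?posrE ?ltr0n ?ler_nat.
  - by rewrite lerXn2r ?nnegrE ?expR_ge0 // ler_expR lerDl.
  apply: ex_le => b _.
  have [bC|bC] := leqP (nsub b) C; last first.
    rewrite big_nat_cond big1 ?mulr_ge0 ?subr_ge0 ?th1 ?nsub_gt0 ?weight_ge0 //.
    move=> f /andP[/andP[_ fC] _]; case: eqP => [e|]; last by rewrite mulr0.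
    by move: bC; rewrite e ltnNge -ltnS fC.
  rewrite (bigD1_seq (nsub b)) /= ?iota_uniq ?mem_index_iota ?nsub_gt0 ?ltnS //.
  rewrite eqxx mulr1 big1 => [|f /negbTE]; last by rewrite eq_sym => ->; rewrite mulr0.
  rewrite addr0; apply: le_trans (tilt_gain _ (ltW s0) sC) _; first by rewrite nsub_gt0.
  apply: ler_wpM2l; first by rewrite subr_ge0; apply: th1 (nsub_gt0 b).
  exact: weight_ge_expR (ltW s0).
have ANS N : A N.+1 <= expR (x * A N - P N.+1).
  apply: le_trans (ex_weight_sum_le th0 N.+1 x0) _; rewrite ler_expR.
  rewrite /A /P mulr_sumr -sumrB; apply: ler_sum => j _.
  rewrite mulrCA -exprS -mulrBl ler_wpM2r ?exprn_ge0 // lerBrDr -exD.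
  by apply: ex_le => b _; rewrite -mulrDl addrC subrK mul1r.
(* Up to size C, the change from 1/e to x costs at most exp (d C), which the gap [eta] pays for. *)
have AC : A C <= expR (1 - d).
  apply: le_trans (_ : expR (d * C%:R) * (expR 1 * (1 - eta)) <= _); last first.
    apply: le_trans (_ : expR (d * C%:R) * (expR 1 * expR (- eta)) <= _).
      by rewrite !ler_pM2l ?expR_gt0 // expR_ge1Dx.
    rewrite -!expRD ler_expR; move: dE; rewrite -natr1 mulrDr mulr1; lra.
  apply: le_trans (_ : expR (d * C%:R) * \sum_(n < C.+1) nforests n * expR (-1) ^+ n <= _).
    rewrite mulr_sumr; apply: ler_sum => n _.
    rewrite mulrCA; apply: ler_pM.
    - by apply: ex_ge0 => b _; apply: weight_ge0.
    - by rewrite exprn_ge0.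
    - by apply: ex_le => b _; apply: weight_le1; apply: ltW.
    rewrite /x addrC expRD exprMn ler_pM2r ?exprn_gt0 ?expR_gt0 //.
    by rewrite -expRM_natr ler_expR ler_wpM2l // ler_nat -ltnS.
  by rewrite ler_pM2l ?expR_gt0.
(* If A_N <= exp (1 - d) then x A_N <= 1, and subtracting P_(N+1) >= d in the exponent restores the
   bound. *)
have AN N : (C <= N)%N -> A N <= expR (1 - d).
  elim: N => [|N IH]; first by rewrite leqn0 => /eqP <-.
  rewrite leq_eqVlt => /orP[/eqP <-//|]; rewrite ltnS => CN.
  apply: le_trans (ANS N) _; rewrite ler_expR lerB //.
    apply: le_trans (_ : x * expR (1 - d) <= _); first by rewrite ler_wpM2l ?IH.
    by rewrite /x -expRD (_ : -1 + d + (1 - d) = 0) ?expR0 //; ring.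
  apply: le_trans PC _; rewrite /P -!(big_mkord xpredT
    (fun j => ex j (fun b => (1 - th (nsub b)) * weight th b) * x ^+ j.+1)).
  rewrite (@big_cat_nat _ _ _ C 0%N N.+1) ?leqW // /= lerDl; apply: sumr_ge0 => j _.
  rewrite mulr_ge0 ?exprn_ge0 //; apply: ex_ge0 => b _.
  by rewrite mulr_ge0 ?weight_ge0 // subr_ge0 th1 ?nsub_gt0.
move=> N CN.
have : ex N (weight th) * x ^+ N <= expR (1 - d).
  apply: le_trans (AN _ CN); rewrite /A big_ord_recr /= lerDr; apply: sumr_ge0 => j _.
  by rewrite mulr_ge0 ?exprn_ge0 //; apply: ex_ge0 => b _; apply: weight_ge0.
rewrite -ler_pdivlMr ?exprn_gt0 ?expR_gt0 //; move/le_trans; apply.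
rewrite /x -expRM_natr -expRN -expRD ler_expR -natr1; lra.
Qed.

End WeightedForests.

(** * The Galton-Watson law *)

Section MarkedComponent.
Variable R : realType.

(* With [h] the logarithm of a multiplicative statistic of the trees, [mark h] is
   that of the forest: it plays the role of a derivation. *)
Fixpoint mark (h : nat -> R) (b : shape) : R :=
  if b is Node c d then h (nsub c) + mark h d else 0.

Lemma ex_rec n (u : shape -> R) : n%:R * ex n u =
  \sum_(j < n) j.+1%:R * ex j (fun c => ex (n.-1 - j) (fun d => u (Node c d))).
Proof. by case: n => [|m]; [rewrite mul0r big_ord0|rewrite exS]. Qed.

Lemma triangle_exchange m (Y : nat -> nat -> R) :
  \sum_(j < m.+1) \sum_(i < m - j) Y j i = \sum_(i < m.+1) \sum_(j < m - i) Y j i.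
Proof.
have le j : (m - j <= m.+1)%N by rewrite leqW ?leq_subr.
under eq_bigr => j _ do rewrite (big_ord_widen _ (Y j) (le j)).
under [RHS]eq_bigr => i _ do rewrite (big_ord_widen _ (Y^~ i) (le i)).
rewrite (exchange_big_dep xpredT) //=; apply: eq_bigr => i _.
by apply: eq_bigl => j; lia.
Qed.

(** A forest with a marked tree is a pair of a tree and a forest, with no distinguished vertex
    involved. *)
Lemma ex_mark h n (v : nat -> R) : ex n (fun b => mark h b * v (nsub b)) =
  \sum_(j < n) ex j (fun c => h (nsub c) *
    ex (n.-1 - j) (fun d => v ((nsub c).+1 * nsub d)%N)).
Proof.
elim/ltn_ind: n v => -[|m] IH v; first by rewrite big_ord0 ex0 mul0r.
apply: (mulfI (x := m.+1%:R)); first by rewrite pnatr_eq0.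
pose Y j i := j.+1%:R * ex j (fun c => ex i (fun c' => h (nsub c') *
  ex ((m - j).-1 - i) (fun d => v ((nsub c).+1 * ((nsub c').+1 * nsub d))%N))).
pose X j := ex j (fun c => h (nsub c) *
    ex (m - j) (fun d => v ((nsub c).+1 * nsub d)%N)).
(* In the first term the marked tree contains the distinguished vertex, in [Y] it does not;
   resummed, [Y] gives (m - j) X j, and the factors add up to m + 1. *)
transitivity (\sum_(j < m.+1) (j.+1%:R * X j + \sum_(i < m - j) Y j i)).
  rewrite exS; apply: eq_bigr => j _.
  rewrite -[X in _ = _ + X](_ : j.+1%:R * ex j (fun c => ex (m - j) (fun d =>
    mark h d * v ((nsub c).+1 * nsub d)%N)) = _); last first.
    rewrite /Y -mulr_sumr; congr (_ * _).
    transitivity (ex j (fun c => \sum_(i < m - j) 1 * ex i (fun c' => h (nsub c') *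
      ex ((m - j).-1 - i) (fun d => v ((nsub c).+1 * ((nsub c').+1 * nsub d))%N)))).
      apply: ex_ext => c.
      rewrite (IH (m - j)%N _ (fun y => v ((nsub c).+1 * y)%N)); last by rewrite ltnS leq_subr.
      by apply: eq_bigr => i _; rewrite mul1r.
    by rewrite ex_sum; apply: eq_bigr => i _; rewrite mul1r.
  rewrite -mulrDr -exD; congr (_ * _); apply: ex_ext => c.
  by rewrite -exZ -exD; apply: ex_ext => d /=; rewrite mulrDl.
transitivity (\sum_(j < m.+1) (j.+1%:R * X j + (m - j)%:R * X j)); last first.
  rewrite mulr_sumr; apply: eq_bigr => j _; rewrite -mulrDl -natrD.
  by congr (_%:R * _); have := ltn_ord j; lia.
rewrite !big_split; congr (_ + _); rewrite (triangle_exchange m Y).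
apply: eq_bigr => i _; rewrite /X -exZ.
transitivity (ex i (fun c' => \sum_(j < m - i) j.+1%:R * ex j (fun c => h (nsub c') *
  ex ((m - j).-1 - i) (fun d => v ((nsub c).+1 * ((nsub c').+1 * nsub d))%N)))).
  by rewrite ex_sum; apply: eq_bigr => j _; rewrite /Y exC.
apply: ex_ext => c'; rewrite mulrCA ex_rec mulr_sumr; apply: eq_bigr => j _.
rewrite mulrCA; congr (_ * _); rewrite -exZ; apply: ex_ext => c; congr (_ * _).
have -> : ((m - j).-1 - i = (m - i).-1 - j)%N by lia.
by apply: ex_ext => d /=; rewrite mulnCA.
Qed.

End MarkedComponent.

(** * Recursion for the law of f from a prime valuation *)

Section Recursion.
Variables (R : realType).

Lemma fcount_ge0 n f : 0 <= fcount R n f.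
Proof. exact: ex_ge0. Qed.

Lemma fcount_eq0 n f : (f <= n)%N -> fcount R n f = 0.
Proof.
move=> fn; apply/eqP; rewrite eq_le fcount_ge0 andbT -(ex_const0 R n).
apply: ex_le => b bn; rewrite (_ : _ == f = false) //.
by have := nsub_gt b; rewrite bn => h; apply/eqP => e; lia.
Qed.

Lemma fprob_ge0 C f : 0 <= fprob R C f.
Proof. by apply: sumr_ge0 => j _; rewrite mulr_ge0 ?exprn_ge0 ?expR_ge0 ?fcount_ge0. Qed.

Lemma fprob1 C : (0 < C)%N -> expR (-1) <= fprob R C 1.
Proof.
case: C => // C _; rewrite /fprob big_ord_recl {1}/fcount ex0 eqxx mulr1 expr1 lerDl.
by apply: sumr_ge0 => j _; rewrite mulr_ge0 ?exprn_ge0 ?expR_ge0 ?fcount_ge0.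
Qed.

Lemma mark_logn q b : mark (fun y => (logn q y.+1)%:R) b = (logn q (nsub b))%:R :> R.
Proof.
elim: b => [|c _ d IHd] /=; first by rewrite logn1.
by rewrite IHd lognM ?nsub_gt0 // natrD.
Qed.

(** Marking by v_q(y + 1) yields v_q of the value. A pair p stands for a marked tree of value p.1 -
    1 and a remaining forest of value p.2; a partial list leaves an inequality. *)
Lemma fcount_rec q n f (ds : seq (nat * nat)) :
  uniq ds -> {in ds, forall p, (0 < p.1)%N /\ (p.1 * p.2)%N = f} ->
  \sum_(p <- ds) (logn q p.1)%:R *
     \sum_(j < n) fcount R j p.1.-1 * fcount R (n.-1 - j) p.2
  <= (logn q f)%:R * fcount R n f.
Proof.
move=> uds dsf.
have -> : (logn q f)%:R * fcount R n f = ex n (fun b =>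
    mark (fun y => (logn q y.+1)%:R) b * (nsub b == f)%:R).
  rewrite -exZ; apply: ex_ext => b; rewrite mark_logn.
  by case: eqP => [->|_] //; rewrite !mulr0.
rewrite (ex_mark _ _ (fun y => (y == f)%:R)).
under eq_bigr => p _ do rewrite mulr_sumr.
rewrite exchange_big /=; apply: ler_sum => j _.
under eq_bigr => p _ do rewrite /fcount -exZr.
rewrite -ex_sum; apply: ex_le => c _.
under eq_bigr => p _ do rewrite mulrCA -exZ -exZ.
rewrite -exZ.
under eq_bigr => p _ do rewrite -[ex _ _]mul1r.
rewrite -(ex_sum _ _ _ (fun=> 1) (fun p b => (nsub c == p.1.-1)%:R *
   ((logn q p.1)%:R * (nsub b == p.2)%:R))).
apply: ex_le => d _.
under eq_bigr => p _ do rewrite mul1r.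
pose p0 := ((nsub c).+1, nsub d).
have key p : p \in ds -> p != p0 -> (nsub c == p.1.-1)%:R *
   ((logn q p.1)%:R * (nsub d == p.2)%:R) = 0 :> R.
  move=> /dsf [p0' _] pp.
  case: eqP => [e1|]; last by rewrite mul0r.
  case: eqP => [e2|]; last by rewrite !mulr0.
  by case/eqP: pp; rewrite /p0 e1 e2 prednK //; case: (p).
have [p0ds|p0ds] := boolP (p0 \in ds).
  rewrite (bigD1_seq p0) //= big_seq_cond big1 ?addr0; last first.
    by move=> p /andP[pds pp]; apply: key.
  rewrite !eqxx mul1r mulr1; have [_ /= ->] := dsf _ p0ds.
  by rewrite eqxx mulr1.
rewrite big_seq_cond big1 ?mulr_ge0 // => p /andP[pds _]; apply: key => //.
by apply: contraNneq p0ds => <-.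
Qed.

Lemma triangle_sum C (G : nat -> nat -> R) :
  (forall j k, (C <= j + k + 1)%N -> G j k = 0) ->
  \sum_(j < C) \sum_(k < C) G j k = \sum_(n < C) \sum_(j < n) G j (n.-1 - j)%N.
Proof.
move=> G0.
transitivity (\sum_(n < C) \sum_(j < C | (j < n)%N) G j (n.-1 - j)%N); last first.
  apply: eq_bigr => n _.
  by rewrite (big_ord_widen _ (fun j => G j (n.-1 - j)%N) (ltnW (ltn_ord n))).
rewrite [RHS](exchange_big_dep xpredT) //=; apply: eq_bigr => j _.
rewrite -(big_mkord xpredT (G j)).
rewrite -(big_mkord (fun n => (j < n)%N) (fun n => G j (n.-1 - j)%N)).
have jC := ltn_ord j.
rewrite (@big_cat_nat _ _ _ (C - j.+1)) ?leq_subr //=.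
rewrite [X in _ + X]big_nat_cond [X in _ + X]big1 ?addr0; last first.
  by move=> k /andP[/andP[k1 k2] _]; apply: G0; lia.
rewrite [RHS](@big_cat_nat _ _ _ j.+1) //=.
rewrite [X in _ = X + _]big_nat_cond [X in _ = X + _]big1 ?add0r; last first.
  by move=> k /andP[/andP[_ k1]]; lia.
rewrite -[j.+1 in RHS]add0n big_addn; rewrite [RHS]big_mkcond /=.
apply: eq_bigr => k _; have -> : (j < k + j.+1)%N by lia.
by congr (G _ _); lia.
Qed.

Lemma fprob_rec C q f (ds : seq (nat * nat)) : (0 < f <= C)%N ->
  uniq ds -> {in ds, forall p, (0 < p.1)%N /\ (p.1 * p.2)%N = f} ->
  \sum_(p <- ds) (logn q p.1)%:R * (fprob R C p.1.-1 * fprob R C p.2)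
  <= (logn q f)%:R * fprob R C f.
Proof.
move=> /andP[f0 fC] uds dsf.
rewrite {3}/fprob mulr_sumr.
apply: le_trans (_ : \sum_(n < C) expR (-1) ^+ n.+1 * \sum_(p <- ds) (logn q p.1)%:R *
     \sum_(j < n) fcount R j p.1.-1 * fcount R (n.-1 - j) p.2 <= _); last first.
  apply: ler_sum => n _; rewrite [leRHS]mulrCA ler_wpM2l ?exprn_ge0 ?expR_ge0 //.
  exact: fcount_rec.
under [leRHS]eq_bigr => n _ do rewrite mulr_sumr.
rewrite exchange_big /= !big_seq; apply: ler_sum => p pds.
have [p1 pf] := dsf _ pds.
under eq_bigr => n _ do rewrite mulrCA.
rewrite -mulr_sumr ler_wpM2l // /fprob big_distrlr /=.
pose G j k := expR (-1) ^+ j.+1 * fcount R j p.1.-1 * (expR (-1) ^+ k.+1 * fcount R k p.2) : R.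
(* Cutting sizes at C loses nothing: a nonzero term has j < p.1 - 1 and k < p.2, so j + k + 1 < p.1
   - 1 + p.2 <= f <= C. *)
rewrite (triangle_sum (G := G)) => [|j k jk]; last first.
  rewrite /G; have [h|h] := leqP p.1.-1 j; first by rewrite fcount_eq0 // mulr0 mul0r.
  rewrite [fcount R k _]fcount_eq0 ?mulr0 // leqNgt; apply/negP => h'.
  have : (p.1.-1 + p.2 <= p.1 * p.2)%N.
    by rewrite -{2}(prednK p1) mulSn addnC leq_add2l leq_pmulr //; lia.
  by rewrite pf; lia.
rewrite le_eqVlt; apply/orP; left; apply/eqP; apply: eq_bigr => n _.
rewrite mulr_sumr; apply: eq_bigr => j _; rewrite /G mulrACA -exprD.
by congr (_ ^+ _ * _); have := ltn_ord j; lia.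
Qed.

End Recursion.

(** * Numerical evaluation of the mean toll *)

Section LogBounds.
Variable R : realType.

(** The truncated series of ln ((1 + z) / (1 - z)); its derivative is a geometric sum below 2 / (1 -
    y^2). *)
Lemma ln_ratio_ge J (z : R) : 0 <= z < 1 ->
  \sum_(j < J) 2 / (2 * j + 1)%:R * z ^+ (2 * j + 1) <= ln (1 + z) - ln (1 - z).
Proof.
move=> /andP[z0 z1].
pose p : {poly R} := \sum_(j < J) (2 / (2 * j + 1)%:R) *: 'X^(2 * j + 1).
have -> : \sum_(j < J) 2 / (2 * j + 1)%:R * z ^+ (2 * j + 1) = p.[z].
  by rewrite horner_sum; apply: eq_bigr => j _; rewrite hornerZ hornerXn.
have dp y : p^`().[y] = \sum_(j < J) 2 * (y ^+ 2) ^+ j.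
  rewrite raddf_sum horner_sum; apply: eq_bigr => j _.
  rewrite /= derivZ derivXn addn1 hornerZ hornerMn hornerXn -exprM.
  by rewrite -[y ^+ _ *+ _]mulr_natl mulrA divfK ?pnatr_eq0.
pose f y := p.[y] - (ln (1 + y) - ln (1 - y)) : R.
suff : f z <= f 0.
  have p0 : p.[0] = 0.
    rewrite horner_sum big1 // => j _.
    by rewrite hornerZ hornerXn addn1 expr0n mulr0.
  by rewrite /f p0 addr0 subr0 ln1 subrr subr0 subr_le0.
apply: (@derive_le0_le R f (fun y => p^`().[y] - ((1 + y)^-1 + (1 - y)^-1))) => //.
  move=> y /andP[y0 yz].
  have h0 := is_derive_poly p y.
  have p1 : 0 < 1 + y by lra.
  have p2 : 0 < 1 - y by lra.
  have g1 : is_derive y 1 (fun w : R => 1 + w) 1.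
    by have := is_deriveD (is_derive_cst (1 : R) y 1) (is_derive_id y 1); rewrite add0r.
  have g2 : is_derive y 1 (fun w : R => 1 - w) (-1).
    by have := is_deriveB (is_derive_cst (1 : R) y 1) (is_derive_id y 1); rewrite sub0r.
  have h1 : is_derive y 1 (fun w : R => ln (1 + w)) (1 + y)^-1.
    by have := is_derive1_comp (is_derive1_ln p1) g1; rewrite mulr1.
  have h2 : is_derive y 1 (fun w : R => ln (1 - w)) (- (1 - y)^-1).
    by have := @is_derive1_comp R (@ln R) (fun w => 1 - w) y _ _ (is_derive1_ln p2) g2; rewrite mulrN1.
  by have := is_deriveB h0 (is_deriveB h1 h2); rewrite opprK.
move=> y /andP[y0 yz]; rewrite dp -mulr_sumr.
have p1 : 0 < 1 + y by lra.
have p2 : 0 < 1 - y by lra.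
have p3 : 0 < 1 - y ^+ 2 by rewrite subr_gt0 expr_lt1 ?(ltW y0) //; lra.
have -> : (1 + y)^-1 + (1 - y)^-1 = 2 / (1 - y ^+ 2).
  by field; rewrite !gt_eqF.
rewrite subr_le0 ler_pM2l // -div1r ler_pdivlMr // mulrC.
by rewrite -opprB mulNr -subrX1 opprB gerBl exprn_ge0 // sqr_ge0.
Qed.

End LogBounds.

Section NumericalConstants.
Variable R : realType.

Lemma expR_ge_sum n (x : R) : 0 <= x -> \sum_(k < n) x ^+ k / k`!%:R <= expR x.
Proof.
move=> x0.
have := @nondecreasing_cvgn_le R (series (exp_coeff x)) _ _ n.
rewrite /series /= big_mkord; apply; last exact: is_cvg_series_exp_coeff.
apply/nondecreasing_seqP => k; rewrite /series /= big_nat_recr //= lerDl.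
exact: exp_coeff_ge0.
Qed.

Lemma expRN1_ge_ratio J (r z : R) : 0 < r -> 0 <= z < 1 -> 1 - z = r * (1 + z) ->
  1 <= \sum_(j < J) 2 / (2 * j + 1)%:R * z ^+ (2 * j + 1) -> r <= expR (-1).
Proof.
move=> r0 zb rz /le_trans/(_ (ln_ratio_ge J zb)).
have z1 : 0 < 1 + z by lra.
by rewrite rz lnM ?posrE // opprD addrCA subrr addr0 lerNr -{2}(lnK r0) ler_expR.
Qed.

Lemma expRN1_ge : 3678794%:R / 10000000%:R <= expR (-1) :> R.
Proof.
(* This z is (1 - r) / (1 + r) for r = 0.3678794. *)
have sum_ge (z : R) : z = 6321206%:R / 13678794%:R ->
    1 <= \sum_(j < 9) 2 / (2 * j + 1)%:R * z ^+ (2 * j + 1).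
  move=> ez; rewrite !big_ord_recr big_ord0 /=.
  change (1 <= 0 + 2 / 1%:R * z ^+ 1 + 2 / 3%:R * z ^+ 3 + 2 / 5%:R * z ^+ 5 +
    2 / 7%:R * z ^+ 7 + 2 / 9%:R * z ^+ 9 + 2 / 11%:R * z ^+ 11 +
    2 / 13%:R * z ^+ 13 + 2 / 15%:R * z ^+ 15 + 2 / 17%:R * z ^+ 17).
  by rewrite ez; lra.
apply: expRN1_ge_ratio (sum_ge _ (erefl _)); lra.
Qed.

Lemma ln_base_le : ln (141805%:R / 100000%:R) <= 349283%:R / 1000000%:R :> R.
Proof.
have exp_ge (c : R) : c = 349283%:R / 1000000%:R ->
    141805%:R / 100000%:R <= \sum_(k < 8) c ^+ k / k`!%:R.
  move=> ec; rewrite !big_ord_recr big_ord0 /=.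
  change (141805%:R / 100000%:R <= 0 + 1 / 1%:R + c / 1%:R + c ^+ 2 / 2%:R +
    c ^+ 3 / 6%:R + c ^+ 4 / 24%:R + c ^+ 5 / 120%:R + c ^+ 6 / 720%:R +
    c ^+ 7 / 5040%:R).
  by rewrite ec; lra.
have {}exp_ge := exp_ge _ (erefl _).
rewrite -[leRHS]expRK ler_ln ?posrE ?expR_gt0; [|by lra|by []].
by apply: le_trans exp_ge (expR_ge_sum 8 _); lra.
Qed.

End NumericalConstants.

(** * Fixed-point computation with binary integers *)

Fixpoint valuation (k : nat) (q d : N) : N :=
  if k is k'.+1 then
    if N.eqb (N.modulo d q) 0 then N.succ (valuation k' q (N.div d q)) else 0%num
  else 0%num.

Fixpoint divisor_pairs (k : nat) (e f : N) : seq (N * N) :=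
  if k is k'.+1 then
    if N.ltb f (N.mul e e) then [::] else
    let s := divisor_pairs k' (N.succ e) f in
    let (d, m) := N.div_eucl f e in
    if N.eqb m 0 then
      if N.eqb d e then (d, e) :: s else [:: (d, e), (e, d) & s]
    else s
  else [::].

(** Entries are lower bounds for [scale * fprob], so absent keys may read as 0. *)
Definition lookup (t : PositiveMap.t N) (f : N) : N :=
  if f is Npos p then odflt 0%num (PositiveMap.find p t) else 0%num.

(** All primes below the square root of 4000: a number from 2 to 4000 with no divisor here is
    prime. *)
Definition small_primes : seq N :=
  [:: 2; 3; 5; 7; 11; 13; 17; 19; 23; 29; 31; 37; 41; 43; 47; 53; 59; 61]%num.

Fixpoint find_divisor (s : seq N) (f : N) : option N :=
  if s is q :: s' then
    if N.eqb (N.modulo f q) 0 then Some q else find_divisor s' f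
  else None.

(* When no small prime divides [f], only the factorisation f = f * 1 is used. *)
Definition fprob_step (scale : N) (t : PositiveMap.t N) (f : N) : N :=
  if find_divisor small_primes f is Some q then
    N.div (foldr (fun p a => N.add (N.mul (valuation 12 q p.1)
             (N.mul (lookup t (N.pred p.1)) (lookup t p.2))) a) 0%num
             (divisor_pairs 64 1 f))
          (N.mul (valuation 12 q f) scale)
  else N.div (N.mul (lookup t (N.pred f)) (lookup t 1)) scale.

(** The series of [ln_ratio_ge] at z = 1 / (2 f + 1), where (1 + z) / (1 - z) = (f + 1) / f, with
    each term rounded down; one term is enough for large f. *)
Definition ln_low (scale f : N) : N :=
  foldr (fun j a =>
    let w := N.succ (N.double j) in
    N.add (N.div (N.double scale) (N.mul w (N.pow (N.succ (N.double f)) w))) a) 0%num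
    (if N.ltb f 64 then [:: 0; 1; 2; 3; 4; 5; 6; 7]%num else [:: 0%num]).

Fixpoint mean_toll_loop (scale : N) (n : nat) (f : N) (t : PositiveMap.t N) (a : N) : N :=
  if n is n'.+1 then
    let v := fprob_step scale t f in
    mean_toll_loop scale n' (N.succ f)
      (if f is Npos p then PositiveMap.add p v t else t)
      (N.add a (N.mul v (ln_low scale f)))
  else a.

Definition mean_toll_low (scale p1 : N) (C : nat) : N :=
  mean_toll_loop scale C.-1 2 (PositiveMap.add 1%positive p1 (PositiveMap.empty N))
    (N.mul p1 (ln_low scale 1)).

(* 0.36787940 is a lower bound for 1/e, and 0.3492832 exceeds ln 1.41805 =
   0.34928268... *)
Lemma mean_toll_low_ge : N.leb 3492832000000000 (mean_toll_low 100000000 36787940 4000).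
Proof. by vm_compute. Qed.

(** * Soundness of the computation *)

Section Certificate.
Variable R : realType.

Definition NR (x : N) : R := (N.to_nat x)%:R.

Lemma NR_ge0 x : 0 <= NR x. Proof. exact: ler0n. Qed.

Lemma NRD x y : NR (N.add x y) = NR x + NR y.
Proof. by rewrite /NR N2Nat.inj_add natrD. Qed.

Lemma NRM x y : NR (N.mul x y) = NR x * NR y.
Proof. by rewrite /NR N2Nat.inj_mul natrM. Qed.

Lemma NR_succ x : NR (N.succ x) = NR x + 1.
Proof. by rewrite /NR N2Nat.inj_succ natr1. Qed.

Lemma NR_double x : NR (N.double x) = 2 * NR x.
Proof. by rewrite /NR N2Nat.inj_double -natrM. Qed.

Lemma NR_pow x y : NR (N.pow x y) = NR x ^+ N.to_nat y.
Proof.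
elim/N.peano_ind: y => [|y IH]; first by rewrite N.pow_0_r.
by rewrite N.pow_succ_r' NRM IH N2Nat.inj_succ exprS.
Qed.

Lemma NR_le x y : N.le x y -> NR x <= NR y.
Proof. by move=> xy; rewrite /NR ler_nat; lia. Qed.

Lemma NR_div x y : NR (N.div x y) * NR y <= NR x.
Proof.
rewrite -NRM; apply: NR_le; rewrite N.mul_comm.
by case: y => [|p]; [exact: N.le_0_l|apply: N.mul_div_le].
Qed.

Lemma modulo_eq0 d q : q <> 0%num ->
  reflect (q * N.div d q = d)%num (N.eqb (N.modulo d q) 0).
Proof.
move=> q0; apply: (iffP idP) => [/N.eqb_eq|] h.
  by rewrite [RHS](N.div_mod d q q0) h N.add_0_r.
by apply/N.eqb_eq; rewrite -h N.mul_comm N.mod_mul.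
Qed.

Lemma valuation_logn k q d : prime (N.to_nat q) -> (0 < N.to_nat d < 2 ^ k)%N ->
  N.to_nat (valuation k q d) = logn (N.to_nat q) (N.to_nat d).
Proof.
move=> pq; have q1 := prime_gt1 pq; have q0 : q <> 0%num by move=> e; rewrite e in q1.
elim: k d => [|k IH] d /andP[d0 dk] /=.
  by move: dk; rewrite expn0; lia.
case: (modulo_eq0 d q0) => h.
  have e : N.to_nat d = (N.to_nat q * N.to_nat (N.div d q))%N.
    by rewrite -[in LHS]h N2Nat.inj_mul.
  have d'0 : (0 < N.to_nat (N.div d q))%N.
    by rewrite lt0n; apply/eqP => e0; rewrite e e0 muln0 in d0.
  rewrite N2Nat.inj_succ IH; last first.
    rewrite d'0 /=; move: dk; rewrite e expnS => dk.
    rewrite -(ltn_pmul2l (isT : (0 < 2)%N)); apply: leq_ltn_trans dk.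
    by rewrite leq_mul2r q1 orbT.
  have lq : logn (N.to_nat q) (N.to_nat q) = 1%N by rewrite logn_prime ?eqxx.
  by rewrite e lognM ?(ltnW q1) // lq.
apply/esym/eqP; rewrite -[_ == _]negbK -lt0n logn_gt0; apply/negP.
rewrite mem_primes pq d0 /= => /dvdnP[m em]; apply: h.
have {}em : d = N.mul (N.of_nat m) q.
  by apply: N2Nat.inj; rewrite em N2Nat.inj_mul Nat2N.id.
by rewrite em N.div_mul // N.mul_comm.
Qed.

(** Soundness suffices, as [fprob_rec] accepts any list of distinct factorisations. The bounds by
    [e] keep the pairs found at [e] from recurring. *)
Lemma divisor_pairs_spec k e f : (0 < e)%num ->
  uniq (divisor_pairs k e f) /\ {in divisor_pairs k e f, forall p,
    [/\ (e <= p.1)%num, (e <= p.2)%num & (p.1 * p.2)%num = f]}.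
Proof.
elim: k e => [|k IH] e e0 //=.
case: (N.ltb_spec f (e * e)%num) => // ef.
have [|us hs] := IH (N.succ e); first by lia.
have := N.div_eucl_spec f e; case: (N.div_eucl f e) => d m.
case: (N.eqb_spec m 0) => [->|_] fE; last first.
  by split=> // p /hs[]; split=> //; lia.
have ed : (e <= d)%num by nia.
have de : (d * e)%num = f by nia.
have fresh1 : (d, e) \notin divisor_pairs k (N.succ e) f.
  by apply/negP => /hs[_ h _]; have : (N.succ e <= e)%num := h; lia.
have fresh2 : (e, d) \notin divisor_pairs k (N.succ e) f.
  by apply/negP => /hs[h _ _]; have : (N.succ e <= e)%num := h; lia.
have hs' p : p \in divisor_pairs k (N.succ e) f ->
    [/\ (e <= p.1)%num, (e <= p.2)%num & (p.1 * p.2)%num = f].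
  by move=> /hs[h1 h2 h3]; split=> //; apply: N.le_trans (N.le_succ_diag_r e) _.
case: (N.eqb_spec d e) => de'; split.
- by rewrite /= fresh1.
- by move=> p; rewrite inE => /orP[/eqP->|/hs'//]; split; cbn [fst snd]; lia.
- rewrite /= !inE negb_or fresh1 fresh2 us !andbT.
  by apply/eqP => -[h _]; apply: de'.
- move=> p; rewrite !inE => /or3P[/eqP->|/eqP->|/hs'//]; split; cbn [fst snd]; lia.
Qed.

Local Arguments valuation : simpl never.
Local Arguments divisor_pairs : simpl never.

Lemma small_primes_prime q : q \in small_primes -> prime (N.to_nat q).
Proof. by move: q; apply/allP; vm_compute. Qed.

Lemma find_divisor_spec s f q : find_divisor s f = Some q ->
  q \in s /\ N.eqb (N.modulo f q) 0.
Proof.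
elim: s => //= q' s IH; case: ifP => h; first by move=> [<-]; rewrite mem_head.
by move=> /IH[qs ->]; rewrite inE qs orbT.
Qed.

Variables (C : nat) (scale : N).
Hypothesis C4096 : (C < 2 ^ 12)%N.
Hypothesis scale_gt0 : 0 < NR scale.

Definition table_ok (t : PositiveMap.t N) :=
  forall f, NR (lookup t f) <= fprob R C (N.to_nat f) * NR scale.

(** This is [fprob_rec] divided by the valuation of f; products of entries carry [scale] twice, one
    factor is divided out, and rounding goes down. *)
Lemma fprob_step_le t f : table_ok t -> (1 < N.to_nat f <= C)%N ->
  NR (fprob_step scale t f) <= fprob R C (N.to_nat f) * NR scale.
Proof.
move=> tok /andP[f1 fC]; rewrite /fprob_step.
have prod_le a b : NR (N.mul (lookup t a) (lookup t b)) <=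
    fprob R C (N.to_nat a) * fprob R C (N.to_nat b) * (NR scale * NR scale).
  by rewrite NRM mulrACA ler_pM ?NR_ge0.
have f0C : (0 < N.to_nat f <= C)%N by rewrite fC (ltnW f1).
case E : (find_divisor _ _) => [q|]; last first.
  rewrite -(ler_pM2r scale_gt0); apply: le_trans (NR_div _ _) _.
  apply: le_trans (prod_le _ _) _.
  rewrite -[leRHS]mulrA ler_wpM2r ?mulr_ge0 ?NR_ge0 //.
  have pq := pdiv_prime f1.
  have := @fprob_rec R C (pdiv (N.to_nat f)) (N.to_nat f) [:: (N.to_nat f, 1%N)] f0C isT.
  rewrite big_seq1 ler_pM2l; last by rewrite ltr0n logn_gt0 mem_primes pq (ltnW f1) pdiv_dvd.
  rewrite N2Nat.inj_pred; apply=> p; rewrite inE => /eqP-> /=.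
  by rewrite muln1 (ltnW f1).
have [/small_primes_prime pq] := find_divisor_spec E.
have q0 : q <> 0%num by move=> e; rewrite e in pq.
move/(modulo_eq0 f q0) => fq.
have [upairs hpairs] := divisor_pairs_spec 64 f N.lt_0_1.
set s := divisor_pairs 64 1 f in upairs hpairs *.
have valf : N.to_nat (valuation 12 q f) = logn (N.to_nat q) (N.to_nat f).
  by apply: valuation_logn; rewrite // (ltnW f1) (leq_ltn_trans fC).
have logf : 0 < (logn (N.to_nat q) (N.to_nat f))%:R :> R.
  rewrite ltr0n logn_gt0 mem_primes pq (ltnW f1) /=.
  by apply/dvdnP; exists (N.to_nat (N.div f q)); rewrite -[in LHS]fq N2Nat.inj_mul mulnC.
pose toN (p : N * N) := (N.to_nat p.1, N.to_nat p.2).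
have toN_inj : injective toN.
  by move=> [a b] [c d] [/N2Nat.inj-> /N2Nat.inj->].
have dsf : {in map toN s, forall p, (0 < p.1)%N /\ (p.1 * p.2)%N = N.to_nat f}.
  move=> _ /mapP[[d e] /hpairs[h1 _ h3] ->]; split; last by rewrite -h3 N2Nat.inj_mul.
  by have {}h1 : (1 <= d)%num := h1; rewrite /toN; cbn [fst]; lia.
have uds : uniq (map toN s) by rewrite map_inj_uniq.
have := fprob_rec R (N.to_nat q) f0C uds dsf; rewrite big_map => rec.
have sum_le : NR (foldr (fun p a => N.add (N.mul (valuation 12 q p.1)
     (N.mul (lookup t (N.pred p.1)) (lookup t p.2))) a) 0%num s) <=
   (\sum_(p <- s) (logn (N.to_nat q) (N.to_nat p.1))%:R *
     (fprob R C (N.to_nat p.1).-1 * fprob R C (N.to_nat p.2))) * (NR scale * NR scale).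
  clearbody s; have : {subset s <= s} by [].
  move: {1 3 4}s => r; elim: r => [|p r IH] sub /=; first by rewrite big_nil mul0r.
  rewrite big_cons mulrDl NRD; apply: lerD; last first.
    by apply: IH => x xr; apply: sub; rewrite inE xr orbT.
  have [p1 p2 pf] := hpairs p (sub _ (mem_head _ _)).
  rewrite NRM -[leRHS]mulrA {1}/NR valuation_logn //; last first.
    by apply/andP; split; [lia|apply: leq_ltn_trans C4096; apply: leq_trans fC; nia].
  by rewrite ler_wpM2l // -N2Nat.inj_pred; apply: prod_le.
have := NR_div (foldr (fun p a => N.add (N.mul (valuation 12 q p.1)
     (N.mul (lookup t (N.pred p.1)) (lookup t p.2))) a) 0%num s)
     (N.mul (valuation 12 q f) scale).
move=> /le_trans/(_ sum_le); rewrite NRM {2}/NR valf => h.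
rewrite -(ler_pM2r (mulr_gt0 logf scale_gt0)) mulrACA [X in _ <= X * _]mulrC.
by apply: le_trans h _; rewrite ler_wpM2r ?mulr_ge0 ?NR_ge0.
Qed.

Lemma ln_low_le f : (0 < N.to_nat f)%N ->
  NR (ln_low scale f) <= NR scale * (ln (N.to_nat f).+1%:R - ln (N.to_nat f)%:R).
Proof.
move=> f0; set y : R := (N.to_nat f)%:R.
have y1 : 1 <= y by rewrite ler1n.
pose z : R := (2 * y + 1)^-1.
have zE : z * (2 * y + 1) = 1 by rewrite mulVf //; apply/eqP; lra.
have zb : 0 <= z < 1 by apply/andP; split; [rewrite invr_ge0|rewrite invf_lt1]; lra.
have -> : ln (N.to_nat f).+1%:R - ln y = ln (1 + z) - ln (1 - z).
  rewrite -natr1 -/y -!ln_div ?posrE; try lra.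
  congr ln; apply/eqP; rewrite eqr_div; [apply/eqP; lra| |]; rewrite gt_eqF //; lra.
apply: le_trans (_ : NR scale * \sum_(j < (if N.ltb f 64 then 8 else 1)%N)
    2 / (2 * j + 1)%:R * z ^+ (2 * j + 1) <= _); last first.
  by rewrite ler_wpM2l ?NR_ge0 // ln_ratio_ge.
have term j : NR (N.div (N.double scale) (N.mul (N.succ (N.double j))
    (N.pow (N.succ (N.double f)) (N.succ (N.double j))))) <=
    NR scale * (2 / (2 * N.to_nat j + 1)%:R * z ^+ (2 * N.to_nat j + 1)).
  have wE : N.to_nat (N.succ (N.double j)) = (2 * N.to_nat j + 1)%N by lia.
  set w := N.succ _; set D := N.mul w _.
  have DE : NR D = (2 * N.to_nat j + 1)%:R * (2 * y + 1) ^+ (2 * N.to_nat j + 1).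
    by rewrite /D NRM NR_pow /w wE {1}/NR wE NR_succ NR_double.
  have D0 : 0 < NR D by rewrite DE mulr_gt0 ?exprn_gt0 ?ltr0n ?addn1 //; lra.
  rewrite -(ler_pM2r D0); apply: le_trans (NR_div _ _) _.
  rewrite NR_double DE; set n := (_ + 1)%N.
  have n0 : n%:R != 0 :> R by rewrite pnatr_eq0 /n addn1.
  by rewrite -[leRHS]mulrA mulrACA divfK // -exprMn zE expr1n mulr1 mulrC.
pose G i := NR scale * (2 / (2 * i + 1)%:R * z ^+ (2 * i + 1)).
have fold js : NR (foldr (fun j a => let w := N.succ (N.double j) in
    N.add (N.div (N.double scale) (N.mul w (N.pow (N.succ (N.double f)) w))) a) 0%num js) <=
    \sum_(i <- map N.to_nat js) G i.
  elim: js => [|j js IH]; first by rewrite big_nil.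
  by rewrite /= big_cons NRD lerD.
rewrite mulr_sumr -(big_mkord xpredT G) /ln_low.
by case: (N.ltb f 64); apply: fold.
Qed.

Lemma mean_toll_loop_le n f t a : table_ok t -> (1 < N.to_nat f)%N ->
  (N.to_nat f + n <= C.+1)%N ->
  NR a <= NR scale * NR scale *
    \sum_(1 <= g < N.to_nat f) fprob R C g * (ln g.+1%:R - ln g%:R) ->
  NR (mean_toll_loop scale n f t a) <= NR scale * NR scale *
    \sum_(1 <= g < N.to_nat f + n) fprob R C g * (ln g.+1%:R - ln g%:R).
Proof.
elim: n f t a => [|n IH] f t a tok f1 fC aok; first by rewrite addn0.
rewrite [mean_toll_loop _ _ _ _ _]/=; set v := fprob_step scale t f.
have vok : NR v <= fprob R C (N.to_nat f) * NR scale.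
  by apply: fprob_step_le => //; rewrite f1 /=; lia.
have fS : N.to_nat (N.succ f) = (N.to_nat f).+1 by rewrite N2Nat.inj_succ.
have := IH (N.succ f) (if f is Npos p then PositiveMap.add p v t else t)
  (N.add a (N.mul v (ln_low scale f))).
rewrite fS addSnnS; apply=> //.
- case: f f1 fC {aok fS} @v vok => [|p] // f1 fC v vok [|p'] /=; first exact: tok 0%num.
  have [->|pp'] := BinPos.Pos.eq_dec p' p; first by rewrite PositiveMap.gss.
  by rewrite PositiveMap.gso //; apply: (tok (Npos p')).
- exact: ltnW.
rewrite big_nat_recr /= ?(ltnW f1) // mulrDr NRD; apply: lerD => //.
rewrite NRM [leRHS]mulrACA; apply: ler_pM; rewrite ?NR_ge0 //.
  by rewrite mulrC.
by apply: ln_low_le; apply: ltnW.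
Qed.

Lemma mean_toll_low_le p1 : (0 < C)%N -> NR p1 <= expR (-1) * NR scale ->
  NR (mean_toll_low scale p1 C) <= NR scale * NR scale * mean_toll R C.
Proof.
move=> C0 p1_le.
have {}p1_le : NR p1 <= fprob R C 1 * NR scale.
  by apply: le_trans p1_le _; rewrite ler_wpM2r ?NR_ge0 ?fprob1.
have -> : mean_toll R C = \sum_(1 <= g < N.to_nat 2 + C.-1)
    fprob R C g * (ln g.+1%:R - ln g%:R).
  by rewrite /mean_toll (_ : (N.to_nat 2 + C.-1)%N = C.+1) // -[in RHS](prednK C0).
apply: mean_toll_loop_le => //.
- move=> [|p]; first by rewrite mulr_ge0 ?fprob_ge0 ?NR_ge0.
  have [->|pn1] := BinPos.Pos.eq_dec p 1%positive.
    by rewrite /lookup PositiveMap.gss.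
  by rewrite /lookup PositiveMap.gso // PositiveMap.gempty mulr_ge0 ?fprob_ge0 ?NR_ge0.
- by rewrite -[C in (_ <= C.+1)%N](prednK C0).
rewrite (_ : N.to_nat 2 = 2%N) // big_nat1 NRM [leRHS]mulrACA [X in _ <= X * _]mulrC.
by apply: ler_pM; rewrite ?NR_ge0 //; apply: (@ln_low_le 1%num).
Qed.

End Certificate.

(** The constants are variables whose values are built from small numerals, since [NR] passes
    through unary numbers. *)
Lemma mean_toll_gt_of_low (R : realType) (low p1 scale : N) :
  NR R low = (((3%:R * 100%:R + 49%:R) * 100%:R + 28%:R) * 100%:R + 32%:R) * 10%:R ^+ 9 ->
  NR R p1 = (((3%:R * 100%:R + 67%:R) * 100%:R + 87%:R) * 100%:R + 94%:R) * 10%:R ->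
  NR R scale = 10%:R ^+ 8 -> N.leb low (mean_toll_low scale p1 4000) ->
  ln (141805%:R / 100000%:R) < mean_toll R 4000.
Proof.
move=> lowE p1E scaleE /N.leb_le/(NR_le R) low_le.
apply: le_lt_trans (ln_base_le R) _.
have s0 : 0 < NR R scale by rewrite scaleE exprn_gt0.
have p1_le : NR R p1 <= expR (-1) * NR R scale.
  apply: le_trans (_ : 3678794%:R / 10000000%:R * NR R scale <= _).
    by rewrite p1E scaleE; clear; lra.
  by rewrite ler_pM2r //; apply: expRN1_ge.
have C4096 : (4000 < 2 ^ 12)%N by [].
have := @mean_toll_low_le R 4000 scale C4096 s0 p1 isT p1_le.
move=> /(le_trans low_le); rewrite lowE scaleE.
by move: (mean_toll R 4000) => mu; clear; lra.
Qed.

Lemma mean_toll_gt (R : realType) : ln (141805%:R / 100000%:R) < mean_toll R 4000.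
Proof.
have NRlit n : NR R (N.of_nat n) = n%:R by rewrite /NR Nat2N.id.
apply: mean_toll_gt_of_low mean_toll_low_ge.
- transitivity (NR R (N.mul (N.add (N.mul (N.add (N.mul (N.add (N.mul (N.of_nat 3)
    (N.of_nat 100)) (N.of_nat 49)) (N.of_nat 100)) (N.of_nat 28)) (N.of_nat 100))
    (N.of_nat 32)) (N.pow (N.of_nat 10) 9))); first by congr NR; vm_compute.
  by rewrite !(NRM, NRD) NR_pow !NRlit.
- transitivity (NR R (N.mul (N.add (N.mul (N.add (N.mul (N.add (N.mul (N.of_nat 3)
    (N.of_nat 100)) (N.of_nat 67)) (N.of_nat 100)) (N.of_nat 87)) (N.of_nat 100))
    (N.of_nat 94)) (N.of_nat 10))); first by congr NR; vm_compute.
  by rewrite !(NRM, NRD) !NRlit.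
- transitivity (NR R (N.pow (N.of_nat 10) 8)); first by congr NR; vm_compute.
  by rewrite NR_pow NRlit.
Qed.

(** * Decay of the exceptional proportion *)

(** The Stirling-type bound k! <= e k (k / e)^k at k = n + 1. *)
Lemma fact_expR_le (R : realType) n :
  n.+1`!%:R * expR n.+1%:R <= expR 1 * n.+1%:R * n.+1%:R ^+ n.+1 :> R.
Proof.
elim: n => [|n IH]; first by rewrite (_ : 1`! = 1%N) // mul1r expr1 !mulr1.
have n1 : 0 < n.+1%:R :> R by rewrite ltr0n.
have n2 : 0 < n.+2%:R :> R by rewrite ltr0n.
(* e <= (1 + 1/(n+1)) ^ (n+2), from exp (- 1/(n+2)) >= 1 - 1/(n+2) *)
have step : expR 1 * n.+1%:R ^+ n.+2 <= n.+2%:R ^+ n.+2 :> R.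
  have : n.+1%:R / n.+2%:R <= expR (- n.+2%:R^-1) :> R.
    apply: le_trans (expR_ge1Dx _).
    by rewrite -[n.+1%:R](addrK 1) natr1 mulrBl divff ?gt_eqF // mul1r.
  move/(@lerXn2r _ n.+2 _ _) => /(_ _ _)/[!nnegrE].
  rewrite divr_ge0 ?expR_ge0 ?ler0n // => /(_ isT isT).
  rewrite expr_div_n -expRM_natl mulrN divff ?gt_eqF // expRN.
  rewrite ler_pdivrMr ?exprn_gt0 // => h.
  by rewrite -ler_pdivlMl ?expR_gt0.
have e2 : expR n.+2%:R = expR 1 * expR n.+1%:R :> R by rewrite -expRD addrC natr1.
rewrite factS natrM e2 -mulrA [n.+1`!%:R * _]mulrCA.
apply: le_trans (_ : n.+2%:R * (expR 1 * (expR 1 * n.+1%:R * n.+1%:R ^+ n.+1)) <= _).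
  by rewrite !ler_pM2l ?expR_gt0.
rewrite -[expR 1 * _ * _]mulrA -exprS [expR 1 * n.+2%:R]mulrC -mulrA.
by rewrite !ler_pM2l ?expR_gt0.
Qed.

(** With n = N + 1 vertices, the exceptional trees number at most N! exp (n - r n) <= e n^n exp (- r
    n); against n^(n-2) trees this leaves e n^2 exp (- r n). *)
Lemma uniform_tree_prob_ge (R : realType) (a : R) C : 1 <= a -> ln a < mean_toll R C ->
  exists K, forall n, (0 < n)%N -> (C <= n)%N ->
    1 - K * n.+1%:R^-1 <=
    uniform_tree_prob R (fun T : {set {set 'I_n.+1}} => a ^+ n.+1 <= #|subtrees T|%:R) <= 1.
Proof.
move=> a1 amu; have a0 : 0 < a by apply: lt_le_trans a1.
have [s [d [s0 sd ub]]] := ex_weight_bound (ln_ge0 a1) amu.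
pose r := d - s * ln a; have r0 : 0 < r by rewrite subr_gt0.
(* From exp (r n) >= (r n)^3 / 6, the remaining e n^2 exp (- r n) is at most K / n. *)
exists (6 * expR 1 / r ^+ 3) => -[//|m] _; set N := m.+1 => CN.
set n := N.+1; set P := fun T => _.
set total := #|labelled_trees n|.
pose bad := #|[set T in labelled_trees n | #|subtrees T|%:R < a ^+ n]|.
have n0 : 0 < n%:R :> R by rewrite ltr0n.
have total_ge : n%:R ^+ m <= total%:R :> R by rewrite -natrX ler_nat leq_card_labelled_trees.
have total0 : 0 < total%:R :> R by apply: lt_le_trans total_ge; rewrite exprn_gt0.
have split_total : total%:R = #|[set E in labelled_trees n | P E]|%:R + bad%:R :> R.
  rewrite -natrD /total -(cardsID [set E | P E]); congr (_%:R); congr (_ + _)%N.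
    by congr (#|pred_of_set _|); apply/setP => E; rewrite !inE.
  by congr (#|pred_of_set _|); apply/setP => E; rewrite !inE andbC /P real_leNgt ?num_real ?negbK.
have -> : uniform_tree_prob R P = 1 - bad%:R / total%:R.
  rewrite /uniform_tree_prob -/total; apply/esym/eqP.
  by rewrite subr_eq -mulrDl -split_total divff // gt_eqF.
rewrite gerBl divr_ge0 // andbT lerD2l lerN2 ler_pdivrMr //.
(* At least a^(s n) f^(-s), hence at least 1 when f < a^n. *)
pose W b := expR (s * ln a * n%:R) * weight (tilt C s) b.
have badW : bad%:R <= N`!%:R * ex N W.
  apply: card_trees_le => b.
    by rewrite mulr_ge0 ?expR_ge0 ?weight_ge0 // => f; apply: expR_ge0.
  move=> ba; apply: le_trans (_ : expR (s * ln a * n%:R) * expR (- (s * ln (nsub b)%:R)) <= _).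
    rewrite -expRD -[leLHS]expR0 ler_expR subr_ge0 -mulrA ler_pM2l //.
    rewrite mulr_natr -lnXn // ler_ln ?posrE ?exprn_gt0 ?ltr0n ?nsub_gt0 //.
    exact: ltW.
  by rewrite ler_pM2l ?expR_gt0 // weight_ge_expR // ltW.
have W_le : ex N W <= expR n%:R * expR (- (r * n%:R)).
  rewrite /W exZ -expRD; apply: le_trans (_ : expR (s * ln a * n%:R) *
    expR ((1 - d) * n%:R) <= _); first by rewrite ler_pM2l ?expR_gt0 // ub.
  by rewrite -expRD ler_expR /r; lra.
apply: le_trans badW _.
apply: le_trans (_ : expR 1 * n%:R ^+ n * expR (- (r * n%:R)) <= _).
  apply: le_trans (_ : N`!%:R * (expR n%:R * expR (- (r * n%:R))) <= _).
    by rewrite ler_wpM2l.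
  rewrite mulrA ler_pM2r ?expR_gt0 // -(ler_pM2l n0).
  have := fact_expR_le R N; rewrite factS natrM -/n => h.
  by rewrite mulrA [leRHS]mulrA [n%:R * expR 1]mulrC.
apply: le_trans (_ : 6 * expR 1 / r ^+ 3 / n%:R * n%:R ^+ m <= _); last first.
  by rewrite ler_pM2l // !divr_gt0 ?mulr_gt0 ?expR_gt0 ?exprn_gt0.
have e3 : (r * n%:R) ^+ 3 / 6 <= expR (r * n%:R).
  have := @expR_ge1Dxn R (r * n%:R) 2; rewrite (_ : 3`!%:R = 6) // => h.
  by apply: le_trans (h _); [rewrite lerDr|rewrite mulr_ge0 // ltW].
have e3' : expR (- (r * n%:R)) <= 6 / (r * n%:R) ^+ 3.
  rewrite expRN -[leRHS]invf_div lef_pV2 ?posrE ?expR_gt0 //.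
  by apply: divr_gt0; [apply: exprn_gt0; apply: mulr_gt0|rewrite ltr0n].
apply: le_trans (_ : expR 1 * n%:R ^+ n * (6 / (r * n%:R) ^+ 3) <= _).
  by apply: ler_wpM2l => //; rewrite mulr_ge0 ?expR_ge0 ?exprn_ge0 ?ler0n.
rewrite le_eqVlt; apply/orP; left; apply/eqP.
rewrite /n /N !exprS exprMn; set y := _.+2%:R.
by field; rewrite !gt_eqF.
Qed.

Theorem theorem2p5 (R : realType) :
  aas R (fun (n : nat) (T : {set {set 'I_n}}) =>
    (141805%:R / 100000%:R : R) ^+ n <= #|subtrees T|%:R).
Proof.
have a1 : 1 <= 141805%:R / 100000%:R :> R by lra.
have [K hK] := uniform_tree_prob_ge a1 (mean_toll_gt R).
rewrite /aas -cvg_shiftS /=.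
apply: (@squeeze_cvgr _ _ _ _ (fun n => 1 - K * harmonic n) (fun=> 1)).
- near=> n; apply: hK; near: n.
    by exists 1%N => // n /=.
  exact: nbhs_infty_ge.
- rewrite -[X in (_ --> X)%classic]subr0; apply: cvgB; first exact: cvg_cst.
  rewrite -[X in (_ --> X)%classic](mulr0 K); apply: cvgM; first exact: cvg_cst.
  exact: cvg_harmonic.
- exact: cvg_cst.
Unshelve. all: by end_near.
Qed.
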